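(* The free associative algebra $\mathcal{H}^{\mathrm{dif,nc}}_Y=\mathbb{Q}\langle\bar Y\rangle/(\mathsf{v}-1)$ is a graded and connected Hopf algebra with respect to the shifted grading $\deg(t)=|t|-1$. The coproduct is the algebra morphism defined on the generators $u\in\bar Y$ by $$\Delta^{\mathrm{dif}}_Y(u)=\sum_{\substack{t\in\bar Y,\ s_1,\dots,s_{|t|}\in\bar Y\\ u=\mu_t(s_1,\dots,s_{|t|})}} t\otimes s_1\cdots s_{|t|},$$ and the counit is the algebra morphism with $\varepsilon(u)=0$ for any $u\in\bar Y$, $u\ne\mathsf{v}$. This Hopf algebra is neither commutative nor cocommutative.
   Context: A tree means a planar binary rooted tree; its order $|t|$ is the number of its internal (trivalent) vertices. $Y_n$ is the set of trees of order $n$, $Y=\bigcup_{n\ge 0}Y_n$, $\bar Y=\bigcup_{n\ge 1}Y_n$. The root tree (order $0$) is denoted $\mathsf{o}$, the vertex tree (the unique tree of order $1$) is denoted $\mathsf{v}$. For trees $t,s$: $t/s$ (''over'') is obtained by grafting the root of $t$ on the left-most leaf of $s$; $t\backslash s$ (''under'') is obtained by grafting the root of $s$ on the right-most leaf of $t$. Both are associative with unit $\mathsf{o}$, and $(a/b)\backslash c=a/(b\backslash c)$ whenever $b\neq\mathsf{o}$. Every $t\in\bar Y$ can be written uniquely as $t=t^l/\mathsf{v}\backslash t^r$ with $t^l,t^r\in Y$. For $t\in\bar Y$ the $t$-product $\mu_t:\bar Y^{|t|}\to\bar Y$ is obtained by writing $t$ as a monomial in $\mathsf{v}$ for the over and under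 products and replacing the $i$-th copy of $\mathsf{v}$ (from left to right) by $s_i$; equivalently, recursively, with $n=|t|$ and $k=|t^l|$, $$\mu_t(s_1,\dots,s_n)=\mu_{t^l}(s_1,\dots,s_k)/s_{k+1}\backslash\mu_{t^r}(s_{k+2},\dots,s_n),\qquad \mu_{\mathsf{o}}()=\mathsf{o}.$$ In particular $\mu_{\mathsf{v}}(s)=s$. In $\mathcal{H}^{\mathrm{dif,nc}}_Y$ the generator $\mathsf{v}$ is identified with the unit $1$, so the algebra is free on the trees of order at least $2$. *)

(* Defs.v *)
From HB Require Import structures.
From mathcomp Require Import all_boot all_algebra.
From mathcomp Require Import finmap.
From mathcomp Require Import boolp classical_sets cardinality fsbigop.
From mathcomp.multinomials Require Import xfinmap monalg.

Set Implicit Arguments.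
Unset Strict Implicit.
Unset Printing Implicit Defensive.

Import GRing.Theory BigEnoughFSet.
Local Open Scope quotient_scope.
Local Open Scope ring_scope.

Definition bilin_map (K : pzRingType) (U V W : lmodType K) (f : U -> V -> W) :=
  (forall v, linear (f^~ v)) /\ (forall u, linear (f u)).

(* The tensor product of two vector spaces: the free space on U * V modulo  *)
(* the subspace spanned by the bilinearity relations.                       *)

Lemma linear_fun0 (K : pzRingType) (U V : lmodType K) (f : U -> V) :
  linear f -> f 0 = 0.
Proof. by move=> /(_ (-1) 0 0); rewrite scaler0 addr0 scaleN1r addNr. Qed.

Lemma scaler_interchange (K : fieldType) (V : lmodType K) (c d : K)
    (p q r s : V) :
  c *: (d *: p + q) + (d *: r + s) = d *: (c *: p + r) + (c *: q + s).
Proof. by rewrite !scalerDr !scalerA [c * d]mulrC addrACA. Qed.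

(* The operations on tensors are locked: unfolding them during unification  *)
(* is prohibitively expensive.                                              *)
Fact tensor_key : unit. Proof. exact: tt. Qed.

Section TensorDef.
Context {K : fieldType} (U V : lmodType K).

Let F := {malg K[(U * V)%type]}.
Let e (u : U) (v : V) : F := << (u, v) >>.

Definition bilin_rel : {pred F} := fun x => `[<
  forall S : {pred F}, submod_closed S ->
    (forall a u u' v, e (a *: u + u') v - (a *: e u v + e u' v) \in S) ->
    (forall a u v v', e u (a *: v + v') - (a *: e u v + e u v') \in S) ->
    x \in S >].

Lemma bilin_rel_submod : submod_closed bilin_rel.
Proof.
split=> [|a x y /asboolP hx /asboolP hy]; apply/asboolP => S Ss h1 h2.
  by case: Ss.
by case: (Ss) => _; apply; [exact: hx | exact: hy].
Qed.

HB.instance Definition _ :=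
  GRing.isZmodClosed.Build F bilin_rel (bilin_rel_submod : zmod_closed _).

Definition tensor : Type := Quotient.quot bilin_rel.
HB.instance Definition _ := EqQuotient.on tensor.
HB.instance Definition _ := GRing.Zmodule.on tensor.

Definition tens (u : U) (v : V) : tensor := \pi_tensor (e u v).

Lemma tensor_piD : {morph \pi_tensor : x y / x + y >-> x + y}.
Proof. by move=> x y; rewrite piE. Qed.

Lemma tensor_piP (x y : F) :
  reflect (\pi_tensor x = \pi_tensor y) (x - y \in bilin_rel).
Proof. by rewrite Quotient.idealrBE; exact: eqP. Qed.

Lemma bilin_relZ a (x : F) : x \in bilin_rel -> a *: x \in bilin_rel.
Proof.
by move=> hx; case: bilin_rel_submod => h0 /(_ a x 0 hx h0); rewrite addr0.
Qed.

Definition tensor_scale : K -> tensor -> tensor :=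
  locked_with tensor_key (fun a x => \pi_tensor (a *: repr x)).

Lemma tensor_piZ a (x : F) : \pi_tensor (a *: x) = tensor_scale a (\pi x).
Proof.
rewrite /tensor_scale locked_withE.
apply/tensor_piP; rewrite -scalerBr; apply/bilin_relZ.
by apply/tensor_piP; rewrite reprK.
Qed.

Lemma tensor_scaleA a b v :
  tensor_scale a (tensor_scale b v) = tensor_scale (a * b) v.
Proof. by elim/quotW: v => x; rewrite -(tensor_piZ b) -!tensor_piZ scalerA. Qed.

Lemma tensor_scale1 : left_id 1 tensor_scale.
Proof. by elim/quotW => x; rewrite -tensor_piZ scale1r. Qed.
Lemma tensor_scaleDr : right_distributive tensor_scale +%R.
Proof.
move=> a; elim/quotW=> x; elim/quotW=> y.
by rewrite -tensor_piD -!tensor_piZ scalerDr tensor_piD.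
Qed.
Lemma tensor_scaleDl v : {morph tensor_scale^~ v : a b / a + b}.
Proof.
move=> a b /=; elim/quotW: v => x.
by rewrite -!tensor_piZ scalerDl tensor_piD.
Qed.

HB.instance Definition _ := GRing.Zmodule_isLmodule.Build K tensor
  tensor_scaleA tensor_scale1 tensor_scaleDr tensor_scaleDl.

Lemma tensor_piZE a (x : F) : \pi_tensor (a *: x) = a *: \pi_tensor x.
Proof. exact: tensor_piZ. Qed.

Lemma tens_bilin : bilin_map tens.
Proof.
split=> [v a u u'|u a v v']; rewrite /tens -tensor_piZE -tensor_piD;
  apply/tensor_piP; apply/asboolP => S Ss h1 h2; [exact: h1 | exact: h2].
Qed.

(* tlift f is meaningful for bilinear f only, see tlift_tens.               *)
Section Lift.
Context (W : lmodType K) (f : U -> V -> W).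

Definition tlift : tensor -> W :=
  locked_with tensor_key
    (fun x => \sum_(k <- msupp (repr x)) (repr x)@_k *: f k.1 k.2).

Let flift (x : F) : W := \sum_(k <- msupp x) x@_k *: f k.1 k.2.

Let fliftEw (d : {fset (U * V)%type}) x : (msupp x `<=` d)%fset ->
  flift x = \sum_(k <- d) x@_k *: f k.1 k.2.
Proof.
move=> le; rewrite [LHS](big_fset_incl _ le) => //= k _ /mcoeff_outdom ->.
by rewrite scale0r.
Qed.

Let flift_linear : linear flift.
Proof.
move=> a x y; pose d := (msupp x `|` msupp y)%fset.
have hd : (msupp (a *: x + y) `<=` d)%fset.
  apply: fsubset_trans (msuppD_le _ _) _; apply: fsetUSS => //; exact: msuppZ_le.
rewrite (fliftEw hd) (@fliftEw d x) ?fsubsetUl // (@fliftEw d y) ?fsubsetUr //.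
rewrite scaler_sumr -big_split /=; apply: eq_bigr => k _.
by rewrite mcoeffD mcoeffZ scalerDl scalerA.
Qed.

Let flift0 : flift 0 = 0.
Proof. by rewrite /flift msupp0 big_seq_fset0. Qed.

Let fliftB x y : flift (x - y) = flift x - flift y.
Proof. by have := flift_linear (-1) y x; rewrite !scaleN1r ![- _ + _]addrC. Qed.

Let fliftU u v : flift (e u v) = f u v.
Proof. by rewrite (fliftEw msuppU_le) big_seq_fset1 mcoeffUU scale1r. Qed.

Hypothesis f_bilin : bilin_map f.

Let flift_rel x : x \in bilin_rel -> flift x = 0.
Proof.
move/asboolP => /(_ [pred y | flift y == 0]) h; apply/eqP/h.
- split=> [|a y z]; rewrite !inE ?flift0 // => /eqP hy /eqP hz.
  by rewrite flift_linear hy hz scaler0 addr0.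
- move=> a u u' v; rewrite inE fliftB flift_linear !fliftU.
  by rewrite (f_bilin.1 v a u u') subrr.
- move=> a u v v'; rewrite inE fliftB flift_linear !fliftU.
  by rewrite (f_bilin.2 u a v v') subrr.
Qed.

Let tlift_pi (x : F) : tlift (\pi x) = flift x.
Proof.
rewrite /tlift locked_withE.
apply/eqP; rewrite -subr_eq0 -[\sum_(k <- _) _]/(flift _) -fliftB; apply/eqP/flift_rel.
by apply/tensor_piP; rewrite reprK.
Qed.

Lemma tlift_linear : linear tlift.
Proof.
move=> a; elim/quotW=> x; elim/quotW=> y.
by rewrite -tensor_piZE -tensor_piD !tlift_pi flift_linear.
Qed.

Lemma tlift_tens u v : tlift (tens u v) = f u v.
Proof. by rewrite tlift_pi fliftU. Qed.

End Lift.

Lemma tensor_ind (P : tensor -> Prop) :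
  (forall u v, P (tens u v)) -> P 0 ->
  (forall a x y, P x -> P y -> P (a *: x + y)) -> forall x, P x.
Proof.
move=> Pt P0 PL; elim/quotW=> x; rewrite [x]monalgE.
elim: (X in \sum_(k <- X) _) => [|k s IH].
  by rewrite big_nil; move: P0; rewrite piE.
rewrite big_cons tensor_piD.
have -> : << x@_k *g k >> = x@_k *: e k.1 k.2 :> F.
  by apply/malgP => j; rewrite mcoeffZ !mcoeffU -surjective_pairing mulr_natr.
rewrite tensor_piZE; exact: PL (Pt _ _) IH.
Qed.

Lemma tlift_unique (W : lmodType K) (g h : {linear tensor -> W}) :
  (forall u v, g (tens u v) = h (tens u v)) -> g =1 h.
Proof.
move=> gh; apply: tensor_ind => // [|a x y hx hy]; first by rewrite !linear0.
by rewrite !linearP hx hy.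
Qed.

End TensorDef.

Section TensorOps.
Context {K : fieldType}.

Lemma tensDl (U V : lmodType K) (u u' : U) (v : V) :
  tens (u + u') v = tens u v + tens u' v.
Proof. by have [h _] := tens_bilin U V; have := h v 1 u u'; rewrite !scale1r. Qed.

Lemma tensDr (U V : lmodType K) (u : U) (v v' : V) :
  tens u (v + v') = tens u v + tens u v'.
Proof. by have [_ h] := tens_bilin U V; have := h u 1 v v'; rewrite !scale1r. Qed.

Definition tensor_map (U U' V V' : lmodType K) (f : U -> U') (g : V -> V') :
    tensor U V -> tensor U' V' :=
  tlift (fun u v => tens (f u) (g v)).

Definition tensor_assoc (U V W : lmodType K) :
    tensor (tensor U V) W -> tensor U (tensor V W) :=
  tlift (fun x w => tlift (fun u v => tens u (tens v w)) x).

Definition tensor_swap (U V : lmodType K) : tensor U V -> tensor V U :=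
  tlift (fun u v => tens v u).

End TensorOps.

(* Only a possibly trivial ring: an algType would require a proof that      *)
(* tens 1 1 is nonzero.                                                     *)

Section TensorAlgebra.
Context {K : fieldType} (A B : algType K).

Definition tensor_mul_pure (a : A) (b : B) (y : tensor A B) : tensor A B :=
  tlift (fun a' b' => tens (a * a') (b * b')) y.

Definition tensor_ring_mul : tensor A B -> tensor A B -> tensor A B :=
  locked_with tensor_key (fun x y => tlift (fun a b => tensor_mul_pure a b y) x).

Let pure_bilin a b : bilin_map (fun (a' : A) (b' : B) => tens (a * a') (b * b')).
Proof.
have [h1 h2] := tens_bilin A B; split=> [v c u u'|u c v v'].
  by rewrite mulrDr -scalerAr h1.
by rewrite mulrDr -scalerAr h2.
Qed.

Let pure_linear a b : linear (tensor_mul_pure a b).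
Proof. exact/tlift_linear/pure_bilin. Qed.

Let pureE a b a' b' : tensor_mul_pure a b (tens a' b') = tens (a * a') (b * b').
Proof. exact/tlift_tens/pure_bilin. Qed.

Let pure0 a b : tensor_mul_pure a b 0 = 0.
Proof. exact: linear_fun0 (pure_linear a b). Qed.

Let mul_bilin y : bilin_map (fun a b => tensor_mul_pure a b y).
Proof.
have [h1 h2] := tens_bilin A B.
split=> [b c a a'|a c b b']; elim/(@tensor_ind K A B): y => [a1 b1||d y z IHy IHz].
- by rewrite !pureE mulrDl -scalerAl h1.
- by rewrite !pure0 scaler0 addr0.
- by rewrite 3!pure_linear IHy IHz scaler_interchange.
- by rewrite !pureE mulrDl -scalerAl h2.
- by rewrite !pure0 scaler0 addr0.
- by rewrite 3!pure_linear IHy IHz scaler_interchange.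
Qed.

Lemma tensor_ring_mull y : linear (tensor_ring_mul^~ y).
Proof. by rewrite /tensor_ring_mul locked_withE; exact: tlift_linear (mul_bilin y). Qed.

Let mul_pure a b y : tensor_ring_mul (tens a b) y = tensor_mul_pure a b y.
Proof. by rewrite /tensor_ring_mul locked_withE; exact: (tlift_tens (mul_bilin y)). Qed.

Let mul0 y : tensor_ring_mul 0 y = 0.
Proof. exact: linear_fun0 (tensor_ring_mull y). Qed.

Lemma tensor_ring_mulr x : linear (tensor_ring_mul x).
Proof.
move=> c y z; elim/(@tensor_ind K A B): x => [a b||d x x' IHx IHx'].
- by rewrite !mul_pure pure_linear.
- by rewrite !mul0 scaler0 addr0.
- by rewrite 3!tensor_ring_mull IHx IHx' scaler_interchange.
Qed.

Lemma tensor_ring_mulE a b a' b' :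
  tensor_ring_mul (tens a b) (tens a' b') = tens (a * a') (b * b').
Proof. by rewrite mul_pure pureE. Qed.

Let mulx0 x : tensor_ring_mul x 0 = 0.
Proof. exact: linear_fun0 (tensor_ring_mulr x). Qed.

Lemma tensor_ring_mulA : associative tensor_ring_mul.
Proof.
move=> x y z; elim/(@tensor_ind K A B): x => [a b||d x x' IHx IHx']; last first.
- by rewrite !tensor_ring_mull IHx IHx'.
- by rewrite !mul0.
elim/(@tensor_ind K A B): y => [a' b'||d y y' IHy IHy']; last first.
- by rewrite !(tensor_ring_mull, tensor_ring_mulr) IHy IHy'.
- by rewrite !(mul0, mulx0).
elim/(@tensor_ind K A B): z => [a1 b1||d z z' IHz IHz']; last first.
- by rewrite !tensor_ring_mulr IHz IHz'.
- by rewrite !mulx0.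
by rewrite !tensor_ring_mulE !mulrA.
Qed.

Lemma tensor_ring_mul1 : left_id (tens 1 1) tensor_ring_mul.
Proof.
elim/(@tensor_ind K A B) => [a b||d x x' IHx IHx']; rewrite ?mulx0 //.
  by rewrite tensor_ring_mulE !mul1r.
by rewrite tensor_ring_mulr IHx IHx'.
Qed.

Lemma tensor_ring_mulr1 : right_id (tens 1 1) tensor_ring_mul.
Proof.
elim/(@tensor_ind K A B) => [a b||d x x' IHx IHx']; rewrite ?mul0 //.
  by rewrite tensor_ring_mulE !mulr1.
by rewrite tensor_ring_mull IHx IHx'.
Qed.

Lemma tensor_ring_mulDl : left_distributive tensor_ring_mul +%R.
Proof.
by move=> x y z; have := tensor_ring_mull z 1 x y; rewrite !scale1r.
Qed.

Lemma tensor_ring_mulDr : right_distributive tensor_ring_mul +%R.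
Proof.
by move=> x y z; have := tensor_ring_mulr x 1 y z; rewrite !scale1r.
Qed.

HB.instance Definition _ := GRing.Zmodule_isPzRing.Build (tensor A B)
  tensor_ring_mulA tensor_ring_mul1 tensor_ring_mulr1
  tensor_ring_mulDl tensor_ring_mulDr.

Lemma tensM (a a' : A) (b b' : B) :
  tens a b * tens a' b' = tens (a * a') (b * b').
Proof. exact: tensor_ring_mulE. Qed.

Lemma tens11 : tens (1 : A) (1 : B) = 1. Proof. by []. Qed.

End TensorAlgebra.

Section Hopf.
Context {K : fieldType} (H : algType K).

Definition tensor_mul : tensor H H -> H := tlift (fun a b => a * b).

Record is_bialgebra (D : H -> tensor H H) (eps : H -> K) : Prop := IsBialgebra {
  comul_linear : linear D;
  comul_morph : monoid_morphism D;
  counit_linear : scalar eps;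
  counit_morph : monoid_morphism eps;
  comulA : forall x,
    tensor_assoc (tensor_map D id (D x)) = tensor_map id D (D x);
  counitl : forall x, tlift (fun a b => eps a *: b) (D x) = x;
  counitr : forall x, tlift (fun a b => eps b *: a) (D x) = x
}.

Record is_antipode (D : H -> tensor H H) (eps : H -> K) (S : H -> H) : Prop :=
  IsAntipode {
  antipode_linear : linear S;
  antipodel : forall x, tensor_mul (tensor_map S id (D x)) = (eps x)%:A;
  antipoder : forall x, tensor_mul (tensor_map id S (D x)) = (eps x)%:A
}.

Record is_graded_space (G : nat -> {pred H}) : Prop := IsGradedSpace {
  graded_submod : forall n, submod_closed (G n);
  graded_span : forall x, exists (n : nat) (c : 'I_n -> H),
    (forall i, c i \in G i) /\ x = \sum_i c i;
  graded_free : forall (n : nat) (c : 'I_n -> H),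
    (forall i, c i \in G i) -> \sum_i c i = 0 -> forall i, c i = 0
}.

Definition tensor_deg (G : nat -> {pred H}) (n : nat) (z : tensor H H) : Prop :=
  exists s : seq (H * H),
    (forall p, p \in s -> exists i j, [/\ (i + j)%N = n, p.1 \in G i & p.2 \in G j])
    /\ z = \sum_(p <- s) tens p.1 p.2.

Record is_graded_hopf_algebra (D : H -> tensor H H) (eps : H -> K)
    (G : nat -> {pred H}) : Prop := IsGradedHopf {
  graded_space : is_graded_space G;
  graded1 : 1 \in G 0%N;
  gradedM : forall i j x y, x \in G i -> y \in G j -> x * y \in G (i + j)%N;
  graded_comul : forall n x, x \in G n -> tensor_deg G n (D x);
  graded_counit : forall n x, (0 < n)%N -> x \in G n -> eps x = 0;
  graded_bialgebra : is_bialgebra D eps;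
  graded_antipode : exists S, is_antipode D eps S /\
    forall n x, x \in G n -> S x \in G n
}.

Definition is_connected (G : nat -> {pred H}) : Prop :=
  forall x, x \in G 0%N <-> exists c : K, x = c%:A.

Definition is_commutative : Prop := forall x y : H, x * y = y * x.

Definition is_cocommutative (D : H -> tensor H H) : Prop :=
  forall x, tensor_swap (D x) = D x.

End Hopf.

Definition freealg (K : fieldType) (X : choiceType) : Type :=
  {malg K[{fmonom X}]}.

Section FreeAlgebra.
Context (K : fieldType) (X : choiceType).

HB.instance Definition _ := GRing.Lalgebra.on (freealg K X).

Lemma freealg_scaleAr (k : K) (x y : freealg K X) : k *: (x * y) = x * (k *: y).
Proof.
apply/malgP => m; rewrite mcoeffZ.
rewrite (mcoeffMlw (d1 := msupp x) (d2 := msupp y) m (fsubset_refl _) (fsubset_refl _)).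
rewrite (mcoeffMlw (d1 := msupp x) (d2 := msupp y) m (fsubset_refl _) (msuppZ_le _ _)).
rewrite mulr_sumr; apply: eq_bigr => i _; rewrite mulr_sumr; apply: eq_bigr => j _.
by rewrite mcoeffZ mulrnAr mulrCA.
Qed.

HB.instance Definition _ :=
  GRing.Lalgebra_isAlgebra.Build K (freealg K X) freealg_scaleAr.

Definition freegen (i : X) : freealg K X := << fmu i >>.

Section Extension.
Context (B : algType K) (f : X -> B).

Definition word_eval (w : {fmonom X}) : B := \prod_(i <- fmonom_val w) f i.

Lemma word_eval_mmorphism : mmorphism word_eval.
Proof.
by split=> [x y|]; rewrite /word_eval ?fmM ?fm1 ?big_cat ?big_nil.
Qed.

HB.instance Definition _ :=
  isMultiplicative.Build {fmonom X} B word_eval word_eval_mmorphism.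

Definition freealg_ext : freealg K X -> B := mmap (in_alg B) word_eval.

Lemma freealg_ext_linear : linear freealg_ext.
Proof.
move=> a x y; rewrite /freealg_ext mmapD; congr (_ + _).
by rewrite mmapZ /= mulr_algl.
Qed.

Lemma freealg_ext_morph : monoid_morphism freealg_ext.
Proof.
have h : GRing.multiplicative freealg_ext.
  apply: commr_mmap_is_multiplicative => g m m'.
  by rewrite /GRing.comm /= mulr_algl mulr_algr.
by split; [exact: h.2 | exact: h.1].
Qed.

HB.instance Definition _ :=
  GRing.isLinear.Build K (freealg K X) B *:%R freealg_ext freealg_ext_linear.
HB.instance Definition _ :=
  GRing.isMonoidMorphism.Build (freealg K X) B freealg_ext freealg_ext_morph.

Lemma freealg_extE i : freealg_ext (freegen i) = f i.
Proof. by rewrite /freealg_ext mmapU /= scale1r mul1r /word_eval fmU big_seq1. Qed.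

End Extension.

Lemma freealg_ext_unique (B : algType K) (g h : {lrmorphism freealg K X -> B}) :
  (forall i, g (freegen i) = h (freegen i)) -> g =1 h.
Proof.
move=> gh x; rewrite [x]monalgE !linear_sum; apply: eq_bigr => w _.
have -> : << x@_w *g w >> = x@_w *: << w >> :> freealg K X.
  by apply/malgP => j; rewrite mcoeffZ !mcoeffU mulr_natr.
rewrite !linearZ /=; congr (_ *: _).
have -> : << w >> = \prod_(i <- fmonom_val w) freegen i :> freealg K X.
  case: w => s /=; elim: s => [|i s IH].
    by rewrite big_nil -fmoneE.
  rewrite big_cons -IH /freegen malgME !msuppU !oner_eq0 !big_seq_fset1.
  by rewrite !mcoeffUU mulr1 /mmul /= fmmulE fmuE.
by rewrite !rmorph_prod; apply: eq_bigr => i _; exact: gh.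
Qed.

End FreeAlgebra.

(* Planar binary rooted trees: troot is the tree of order 0, and Node l r   *)
(* has left and right subtrees l and r above its lowest vertex.             *)

Inductive tree : Type := troot | Node of tree & tree.

Fixpoint tree_encode (t : tree) : GenTree.tree unit :=
  if t is Node l r then GenTree.Node 0 [:: tree_encode l; tree_encode r]
  else GenTree.Leaf tt.

Fixpoint tree_decode (t : GenTree.tree unit) : option tree :=
  match t with
  | GenTree.Leaf _ => Some troot
  | GenTree.Node _ [:: l; r] =>
      if (tree_decode l, tree_decode r) is (Some l', Some r')
      then Some (Node l' r') else None
  | _ => None
  end.

Lemma tree_encodeK : pcancel tree_encode tree_decode.
Proof. by elim=> //= l -> r ->. Qed.

HB.instance Definition _ := Countable.copy tree (pcan_type tree_encodeK).

Fixpoint order (t : tree) : nat :=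
  if t is Node l r then (order l + order r).+1 else 0.

Definition tvertex : tree := Node troot troot.

Fixpoint over (t s : tree) : tree :=
  if s is Node l r then Node (over t l) r else t.

Fixpoint under (t s : tree) : tree :=
  if t is Node l r then Node l (under r s) else s.

Lemma Node_over_under l r : Node l r = over l (under tvertex r).
Proof. by []. Qed.

(* The t-product, for size ss = order t.                                    *)
Fixpoint mu (t : tree) (ss : seq tree) : tree :=
  if t is Node l r then
    over (mu l (take (order l) ss))
         (under (nth troot ss (order l)) (mu r (drop (order l).+1 ss)))
  else troot.

Definition Ybar : Type := {t : tree | (0 < order t)%N}.
Definition Ygen : Type := {t : tree | (1 < order t)%N}.

HB.instance Definition _ := Choice.on Ybar.
HB.instance Definition _ := Choice.on Ygen.

Definition vtree : Ybar := Sub tvertex isT.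

(* Identifying v with 1 in the free algebra on Ybar leaves the free algebra *)
(* on the trees of order at least 2; see HY_universal.                      *)
Definition HY : Type := freealg rat Ygen.
HB.instance Definition _ := GRing.Algebra.on HY.

(* insub fails exactly on v, the only tree of Ybar which is not in Ygen.    *)
Definition gen (u : Ybar) : HY :=
  if insub (val u) is Some w then freegen rat w else 1.

(* The index set of the sum defining the coproduct of u; it is finite, see  *)
(* mu_fiber_finite, so that sums over it are not degenerate.                *)
Definition mu_fiber (u : Ybar) : set (Ybar * seq Ybar) :=
  [set p | size p.2 = order (val p.1) /\ mu (val p.1) (map val p.2) = val u].

Definition word_deg (w : {fmonom Ygen}) : nat :=
  (\sum_(u <- fmonom_val w) (order (val u)).-1)%N.

Definition HY_deg (n : nat) : {pred HY} :=
  [pred x : HY | all (fun w => word_deg w == n) (msupp x)].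

(* HY has the universal property of the quotient of the free algebra on     *)
(* Ybar by the two-sided ideal generated by v - 1.                          *)
Lemma HY_universal (B : algType rat) (f : Ybar -> B) : f vtree = 1 ->
  exists2 phi : {lrmorphism HY -> B}, (forall u, phi (gen u) = f u)
    & forall psi : {lrmorphism HY -> B}, (forall u, psi (gen u) = f u) ->
        psi =1 phi.
Proof.
move=> fv; have lt01 (w : Ygen) : (0 < order (val w))%N by apply: ltnW (valP w).
pose g (w : Ygen) := f (Sub (val w) (lt01 w)).
pose phi : {lrmorphism HY -> B} := freealg_ext g.
have genE (w : Ygen) : gen (Sub (val w) (lt01 w)) = freegen rat w.
  by rewrite /gen SubK valK.
exists phi => [u|psi hpsi].
  rewrite /gen; case: insubP => [w _ wu|].
    by rewrite [LHS]freealg_extE /g; congr f; apply: val_inj; rewrite SubK.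
  rewrite rmorph1 -fv; case: u => t /= t0 t1; congr f; apply: val_inj => /=.
  by case: t t0 t1 => // [] [|? ?] [|? ?].
by apply: freealg_ext_unique => w; rewrite -{1}genE hpsi [RHS]freealg_extE.
Qed.

Lemma order_over t s : order (over t s) = (order t + order s)%N.
Proof. by elim: s => [|l IH r _] /=; rewrite ?addn0 // IH addnS addnA. Qed.

Lemma order_under t s : order (under t s) = (order t + order s)%N.
Proof. by elim: t => [|l _ r IH] //=; rewrite IH addnA. Qed.

Lemma order_mu t ss : size ss = order t ->
  order (mu t ss) = (\sum_(s <- ss) order s)%N.
Proof.
elim: t ss => [|l IHl r IHr] ss /= hs; first by rewrite (size0nil hs) big_nil.
have lt : (order l < size ss)%N by rewrite hs ltnS leq_addr.
rewrite order_over order_under IHl ?size_takel ?(ltnW lt) // IHr; last first.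
  by rewrite size_drop hs subSS addKn.
rewrite -[in RHS](cat_take_drop (order l) ss) big_cat /=.
by rewrite (drop_nth troot lt) big_cons.
Qed.

Lemma mu_fiber_finite (u : Ybar) : finite_set (mu_fiber u).
Proof.
pose trees := fix trees n : seq tree := if n is m.+1 then
  troot :: [seq Node l r | l <- trees m, r <- trees m] else [:: troot].
have treesP n t : (order t <= n)%N -> t \in trees n.
  elim: n t => [|n IH] [|l r] //=; rewrite ltnS inE => le; apply/allpairsP.
  by exists (l, r); rewrite !IH // (leq_trans _ le) ?leq_addl ?leq_addr.
pose words := fix words n (s : seq Ybar) : seq (seq Ybar) := if n is m.+1 then
  [::] :: [seq x :: w | x <- s, w <- words m s] else [:: [::]].
have wordsP n s w : (size w <= n)%N -> {subset w <= s} -> w \in words n s.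
  elim: n w => [|n IH] [|x w] //=; rewrite ltnS inE => le sub; apply/allpairsP.
  exists (x, w); rewrite IH // ?sub ?mem_head // => y yw.
  by apply: sub; rewrite inE yw orbT.
pose N := order (val u).
pose Y : seq Ybar := pmap insub (trees N).
have YP (t : Ybar) : (order (val t) <= N)%N -> t \in Y.
  by move=> le; rewrite mem_pmap_sub treesP.
apply: (sub_finite_set _ (finite_seq [seq (t, w) | t <- Y, w <- words N Y])).
move=> [t w] [/= sz e]; have := congr1 order e.
rewrite order_mu ?size_map // big_map => eN.
have szN : (size w <= N)%N.
  rewrite /N -eN -sum1_size; elim: (w) => [|x s IH]; first by rewrite !big_nil.
  by rewrite !big_cons leq_add // (valP x).
apply/allpairsP; exists (t, w); split=> //=; first by rewrite YP // -sz.
apply: wordsP => // x xw; apply: YP.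
by rewrite /N -eN (big_rem x) //= leq_addr.
Qed.

(* Main.v *)
(* Write u = mu_t(s_1, ..., s_n).  The products mu_t are the composition of a *)
(* non-symmetric operad with unit v: substituting twice is associative, since *)
(* mu_(a/b) = mu_a / mu_b and mu_(a\b) = mu_a \ mu_b by the duplicial         *)
(* relations between / and \.  Coassociativity on generators is the resulting *)
(* bijection between two-level decompositions of u, and the counit axioms     *)
(* isolate the decompositions u = mu_v(u) and u = mu_u(v, ..., v).            *)
(* As mu_t(s_1, ..., s_n) has order |s_1| + ... + |s_n|, the coproduct        *)
(* respects the shifted degree.  The algebra is connected, so x - eps(x) is   *)
(* locally nilpotent for convolution, and the antipode is the geometric       *)
(* series inverting id = eps + (id - eps).                                    *)

Require Import Defs.
From HB Require Import structures.
From mathcomp Require Import all_boot all_algebra.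
From mathcomp Require Import finmap.
From mathcomp Require Import boolp classical_sets functions cardinality fsbigop.
From mathcomp.multinomials Require Import monalg.

Set Implicit Arguments.
Unset Strict Implicit.
Unset Printing Implicit Defensive.

Import GRing.Theory.
Local Open Scope classical_set_scope.
Local Open Scope ring_scope.

Local Notation over := Defs.over.
Local Notation under := Defs.under.
Local Notation order := Defs.order.

(** * Linear maps on tensor products *)

Section LinearFunctions.
Context {K : fieldType} (V : lmodType K).

Lemma linear_funD (W : lmodType K) (f : V -> W) :
  linear f -> {morph f : x y / x + y}.
Proof. by move=> lf x y; have := lf 1 x y; rewrite !scale1r. Qed.

Lemma linear_funZ (W : lmodType K) (f : V -> W) :
  linear f -> forall a, {morph f : x / a *: x}.
Proof. by move=> lf a x; have := lf a x 0; rewrite !addr0 (linear_fun0 lf) addr0. Qed.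

Lemma linear_fun_sum (W : lmodType K) (f : V -> W) (I : Type) (r : seq I)
    (F : I -> V) :
  linear f -> f (\sum_(i <- r) F i) = \sum_(i <- r) f (F i).
Proof. by move=> lf; exact: (big_morph f (linear_funD lf) (linear_fun0 lf)). Qed.

Lemma linear_fun_comp (W X : lmodType K) (f : V -> W) (g : W -> X) :
  linear f -> linear g -> linear (g \o f).
Proof. by move=> lf lg a x y /=; rewrite lf lg. Qed.

End LinearFunctions.

Section TensorMaps.
Context {K : fieldType}.

Lemma tensor_map_bilin (U U' V V' : lmodType K) (f : U -> U') (g : V -> V') :
  linear f -> linear g -> bilin_map (fun u v => tens (f u) (g v)).
Proof.
move=> lf lg; have [h1 h2] := tens_bilin U' V'.
by split=> [v a u u'|u a v v']; rewrite ?lf ?lg ?h1 ?h2.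
Qed.

Lemma tensor_map_linear (U U' V V' : lmodType K) (f : U -> U') (g : V -> V') :
  linear f -> linear g -> linear (tensor_map f g).
Proof. by move=> lf lg; apply/tlift_linear/tensor_map_bilin. Qed.

Lemma tensor_mapE (U U' V V' : lmodType K) (f : U -> U') (g : V -> V') u v :
  linear f -> linear g -> tensor_map f g (tens u v) = tens (f u) (g v).
Proof. by move=> lf lg; apply/(tlift_tens (tensor_map_bilin lf lg)). Qed.

Lemma tensor_sum (U V : lmodType K) (x : tensor U V) :
  exists s : seq (U * V), x = \sum_(p <- s) tens p.1 p.2.
Proof.
elim/(@tensor_ind K U V): x => [u v||a x y [s ->] [s' ->]].
- by exists [:: (u, v)]; rewrite big_seq1.
- by exists [::]; rewrite big_nil.
exists ([seq (a *: p.1, p.2) | p <- s] ++ s').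
rewrite big_cat big_map /=; congr (_ + _); rewrite scaler_sumr.
apply: eq_bigr => p _; have [h _] := tens_bilin U V.
by rewrite (linear_funZ (h p.2)).
Qed.

Lemma tensor_linear_eq (U V W : lmodType K) (f g : tensor U V -> W) :
  linear f -> linear g -> (forall u v, f (tens u v) = g (tens u v)) -> f =1 g.
Proof.
move=> lf lg fg x; have [s ->] := tensor_sum x; rewrite !linear_fun_sum //.
by apply: eq_bigr => p _.
Qed.

Lemma tlift_family (U V W X : lmodType K) (F : X -> U -> V -> W) :
  (forall x, bilin_map (F x)) -> (forall u v, linear (fun x => F x u v)) ->
  forall z, linear (fun x => tlift (F x) z).
Proof.
move=> Fb Fl z a x y; have [s ->] := tensor_sum z.
rewrite 3?(linear_fun_sum _ _ (tlift_linear (Fb _))) scaler_sumr -big_split /=.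
by apply: eq_bigr => p _; rewrite 3?tlift_tens // Fl.
Qed.

Section Assoc.
Context (U V W : lmodType K).

Lemma tens_assoc_bilin (w : W) :
  bilin_map (fun (u : U) (v : V) => tens u (tens v w)).
Proof.
have [h1 h2] := tens_bilin U (tensor V W); have [h3 h4] := tens_bilin V W.
by split=> [v a u u'|u a v v']; rewrite ?h1 // h3 h2.
Qed.

Lemma tensor_assoc_bilin :
  bilin_map (fun (x : tensor U V) (w : W) =>
    tlift (fun u v => tens u (tens v w)) x).
Proof.
split=> [w|x]; first exact/tlift_linear/tens_assoc_bilin.
apply: (tlift_family tens_assoc_bilin) => u v; have [_ h4] := tens_bilin V W.
by apply: linear_fun_comp (h4 v) _; case: (tens_bilin U (tensor V W)).
Qed.

Lemma tensor_assoc_linear : linear (@tensor_assoc K U V W).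
Proof. exact/tlift_linear/tensor_assoc_bilin. Qed.

Lemma tensor_assocE u v w :
  @tensor_assoc K U V W (tens (tens u v) w) = tens u (tens v w).
Proof.
rewrite /tensor_assoc (tlift_tens tensor_assoc_bilin).
exact: tlift_tens (tens_assoc_bilin w) _ _.
Qed.

End Assoc.

Lemma tensor_swap_bilin (U V : lmodType K) :
  bilin_map (fun (u : U) (v : V) => tens v u).
Proof. by have [h1 h2] := tens_bilin V U; split. Qed.

Lemma tensor_swap_linear (U V : lmodType K) : linear (@tensor_swap K U V).
Proof. exact/tlift_linear/tensor_swap_bilin. Qed.

Lemma tensor_swapE (U V : lmodType K) (u : U) (v : V) :
  tensor_swap (tens u v) = tens v u.
Proof. exact: (tlift_tens (@tensor_swap_bilin U V)). Qed.

End TensorMaps.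

Section ScalarMaps.
Context {K : fieldType} (U V : lmodType K).

Lemma scale_bilinl (f : U -> K) : scalar f -> bilin_map (fun u (v : V) => f u *: v).
Proof.
move=> lf; split=> [v|u] a x y; first by rewrite lf scalerDl scalerA.
by rewrite scalerDr !scalerA mulrC.
Qed.

Lemma scale_bilinr (f : V -> K) : scalar f -> bilin_map (fun (u : U) v => f v *: u).
Proof.
move=> lf; split=> [v|u] a x y; last by rewrite lf scalerDl scalerA.
by rewrite scalerDr !scalerA mulrC.
Qed.

Lemma functional_bilin (f : U -> K) (g : V -> K) : scalar f -> scalar g ->
  bilin_map (fun u v => f u * g v : K^o).
Proof.
move=> lf lg; split=> [v|u] a x y; first by rewrite lf mulrDl -mulrA.
by rewrite lg mulrDr mulrCA.
Qed.

End ScalarMaps.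

Section TensorAlg.
Context {K : fieldType}.

Lemma tensorM_sum (A B : algType K) (s s' : seq (A * B)) :
  (\sum_(p <- s) tens p.1 p.2) * (\sum_(q <- s') tens q.1 q.2) =
  \sum_(r <- [seq (p.1 * q.1, p.2 * q.2) | p <- s, q <- s']) tens r.1 r.2
    :> tensor A B.
Proof.
rewrite big_allpairs_dep /= mulr_suml; apply: eq_bigr => p _.
by rewrite mulr_sumr; apply: eq_bigr => q _; rewrite tensM.
Qed.

Lemma tensor_scaleAl (A B : algType K) c (x y : tensor A B) :
  c *: (x * y) = (c *: x) * y.
Proof. exact: esym (linear_funZ (@tensor_ring_mull K A B y) c x). Qed.

Lemma tensor_scaleAr (A B : algType K) c (x y : tensor A B) :
  c *: (x * y) = x * (c *: y).
Proof. exact: esym (linear_funZ (@tensor_ring_mulr K A B x) c y). Qed.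

(* The target product [m] is abstract because tensor products do not carry   *)
(* an algebra structure in general, see [tensor_ring_mul].                   *)
Lemma tensor_morph (A B : algType K) (V : lmodType K) (m : V -> V -> V)
    (f : tensor A B -> V) :
  linear f -> (forall y, linear (m^~ y)) -> (forall x, linear (m x)) ->
  (forall a b a' b',
     f (tens (a * a') (b * b')) = m (f (tens a b)) (f (tens a' b'))) ->
  forall x y, f (x * y) = m (f x) (f y).
Proof.
move=> lf ml mr fM x y.
have [s ->] := tensor_sum x; have [s' ->] := tensor_sum y.
rewrite tensorM_sum 3?(linear_fun_sum _ _ lf) big_allpairs_dep /=.
rewrite [RHS](linear_fun_sum _ _ (ml _)); apply: eq_bigr => p _.
by rewrite [RHS](linear_fun_sum _ _ (mr _)); apply: eq_bigr => q _; rewrite fM.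
Qed.

Lemma tensor_map_morph (A A' B B' : algType K) (f : A -> A') (g : B -> B') :
  linear f -> linear g -> monoid_morphism f -> monoid_morphism g ->
  forall x y, tensor_map f g (x * y) = tensor_map f g x * tensor_map f g y.
Proof.
move=> lf lg [_ fM] [_ gM]; apply: tensor_morph.
- exact: tensor_map_linear.
- by move=> y a x x'; rewrite mulrDl tensor_scaleAl.
- by move=> x a y y'; rewrite mulrDr tensor_scaleAr.
by move=> a b a' b'; rewrite !tensor_mapE // tensM fM gM.
Qed.

Lemma tensor_map1 (A A' B B' : algType K) (f : A -> A') (g : B -> B') :
  linear f -> linear g -> monoid_morphism f -> monoid_morphism g ->
  tensor_map f g 1 = 1.
Proof.
move=> lf lg [f1 _] [g1 _]; apply: etrans (tensor_mapE 1 1 lf lg) _.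
by rewrite f1 g1.
Qed.

Lemma tlift_scalel_morph (A B : algType K) (f : A -> K) :
  scalar f -> {morph f : x y / x * y} ->
  {morph tlift (fun a (b : B) => f a *: b) : x y / x * y}.
Proof.
move=> lf fM; have b := @scale_bilinl _ A B _ lf.
apply: (tensor_morph (m := fun x y => x * y) (tlift_linear b)).
- by move=> y a x x'; rewrite mulrDl scalerAl.
- by move=> x a y y'; rewrite mulrDr scalerAr.
- by move=> x y x' y'; rewrite !(tlift_tens b) fM -scalerAl -scalerAr scalerA.
Qed.

Lemma tlift_scaler_morph (A B : algType K) (f : B -> K) :
  scalar f -> {morph f : x y / x * y} ->
  {morph tlift (fun (a : A) b => f b *: a) : x y / x * y}.
Proof.
move=> lf fM; have b := @scale_bilinr _ A B _ lf.
apply: (tensor_morph (m := fun x y => x * y) (tlift_linear b)).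
- by move=> y a x x'; rewrite mulrDl scalerAl.
- by move=> x a y y'; rewrite mulrDr scalerAr.
- by move=> x y x' y'; rewrite !(tlift_tens b) fM -scalerAl -scalerAr scalerA.
Qed.

End TensorAlg.

(** * Convolution and the antipode *)

Section Convolution.
Context {K : fieldType} (H : algType K) (D : H -> tensor H H) (eps : H -> K).
Hypothesis Dbi : is_bialgebra D eps.

Definition convolution (f g : H -> H) (x : H) : H :=
  tlift (fun a b => f a * g b) (D x).

Let D_linear : linear D := comul_linear Dbi.

Lemma mul_bilin (f g : H -> H) :
  linear f -> linear g -> bilin_map (fun a b => f a * g b).
Proof.
move=> lf lg; split=> [v a u u'|u a v v'].
  by rewrite lf mulrDl scalerAl.
by rewrite lg mulrDr scalerAr.
Qed.

Lemma tensor_mul_map (f g : H -> H) (x : tensor H H) : linear f -> linear g ->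
  tensor_mul (tensor_map f g x) = tlift (fun a b => f a * g b) x.
Proof.
move=> lf lg; have [s ->] := tensor_sum x.
have lid : linear (@id H) by [].
have lm : linear (@tensor_mul K H) by apply/tlift_linear/(mul_bilin lid lid).
rewrite (linear_fun_sum _ _ (tensor_map_linear lf lg)) (linear_fun_sum _ _ lm).
rewrite (linear_fun_sum _ _ (tlift_linear (mul_bilin lf lg))).
apply: eq_bigr => p _; rewrite tensor_mapE // (tlift_tens (mul_bilin lf lg)).
exact: (tlift_tens (mul_bilin lid lid)).
Qed.

Lemma convolution_linear f g : linear f -> linear g -> linear (convolution f g).
Proof.
by move=> lf lg; apply: linear_fun_comp => //; apply/tlift_linear/mul_bilin.
Qed.

Lemma convolutionE (f g : H -> H) (s : seq (H * H)) x :
  linear f -> linear g -> D x = \sum_(p <- s) tens p.1 p.2 ->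
  convolution f g x = \sum_(p <- s) f p.1 * g p.2.
Proof.
move=> lf lg Dx; rewrite /convolution Dx.
rewrite (linear_fun_sum _ _ (tlift_linear (mul_bilin lf lg))).
by apply: eq_bigr => p _; rewrite (tlift_tens (mul_bilin lf lg)).
Qed.

Lemma convolutionA f g h : linear f -> linear g -> linear h ->
  convolution (convolution f g) h = convolution f (convolution g h).
Proof.
move=> lf lg lh; apply/funext => x.
have lfg := convolution_linear lf lg; have lgh := convolution_linear lg lh.
have lid : linear (@id H) by [].
have lfgT := tlift_linear (mul_bilin lf lg).
have lghT := tlift_linear (mul_bilin lg lh).
have fgE a b := tlift_tens (mul_bilin lf lg) a b.
have ghE a b := tlift_tens (mul_bilin lg lh) a b.
have [m3 m3l m3E] : exists2 m3 : tensor H (tensor H H) -> H, linear m3 &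
    forall a y, m3 (tens a y) = f a * tlift (fun b c => g b * h c) y.
  have m3b : bilin_map (fun a y => f a * tlift (fun b c => g b * h c) y).
    split=> [y|a] k u u'; first by rewrite lf mulrDl scalerAl.
    by rewrite lghT mulrDr scalerAr.
  exists (tlift (fun a y => f a * tlift (fun b c => g b * h c) y)).
    exact: tlift_linear m3b.
  exact: tlift_tens m3b.
have fghE y z : m3 (tensor_assoc (tens y z)) = tlift (fun a b => f a * g b) y * h z.
  have [h1 _] := tens_bilin (tensor H H) H.
  move: y; apply: tensor_linear_eq => [||a b].
  - exact: linear_fun_comp (h1 z) (linear_fun_comp (@tensor_assoc_linear _ H H H) m3l).
  - by move=> k y y'; rewrite lfgT mulrDl scalerAl.
  by rewrite tensor_assocE m3E ghE fgE mulrA.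
have [s Dx] := tensor_sum (D x).
rewrite (convolutionE lfg lh Dx) (convolutionE lf lgh Dx).
have := congr1 m3 (comulA Dbi x).
rewrite Dx (linear_fun_sum _ _ (tensor_map_linear D_linear lid)).
rewrite (linear_fun_sum _ _ (tensor_map_linear lid D_linear)).
rewrite (linear_fun_sum _ _ (@tensor_assoc_linear _ H H H)).
rewrite !(linear_fun_sum _ _ m3l) => E.
transitivity (\sum_(p <- s) m3 (tensor_assoc (tensor_map D id (tens p.1 p.2)))).
  by apply: eq_bigr => p _; rewrite tensor_mapE // fghE.
rewrite E; apply: eq_bigr => p _.
by rewrite tensor_mapE // m3E.
Qed.

Definition conv_unit (x : H) : H := (eps x)%:A.

Lemma conv_unit_linear : linear conv_unit.
Proof.
by move=> a x y; rewrite /conv_unit (counit_linear Dbi) scalerDl scalerA.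
Qed.

Lemma conv_unitl g : linear g -> convolution conv_unit g = g.
Proof.
move=> lg; apply/funext => x; have [s Dx] := tensor_sum (D x).
rewrite (convolutionE conv_unit_linear lg Dx) -[in RHS](counitl Dbi x) Dx.
have b := @scale_bilinl _ H H _ (counit_linear Dbi).
rewrite (linear_fun_sum _ _ (tlift_linear b)) (linear_fun_sum _ _ lg).
apply: eq_bigr => p _; rewrite (tlift_tens b).
by rewrite /conv_unit mulr_algl (linear_funZ lg).
Qed.

Lemma conv_unitr f : linear f -> convolution f conv_unit = f.
Proof.
move=> lf; apply/funext => x; have [s Dx] := tensor_sum (D x).
rewrite (convolutionE lf conv_unit_linear Dx) -[in RHS](counitr Dbi x) Dx.
have b := @scale_bilinr _ H H _ (counit_linear Dbi).
rewrite (linear_fun_sum _ _ (tlift_linear b)) (linear_fun_sum _ _ lf).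
apply: eq_bigr => p _; rewrite (tlift_tens b).
by rewrite /conv_unit mulr_algr (linear_funZ lf).
Qed.

Definition aug_proj (x : H) : H := x - conv_unit x.

Lemma aug_proj_linear : linear aug_proj.
Proof.
move=> a x y; rewrite /aug_proj conv_unit_linear scalerBr opprD addrACA.
by [].
Qed.

Definition conv_pow k : H -> H := iter k (convolution aug_proj) conv_unit.

Lemma conv_pow_linear k : linear (conv_pow k).
Proof.
elim: k => [|k IH]; first exact: conv_unit_linear.
exact: convolution_linear aug_proj_linear IH.
Qed.

Lemma conv_powSr k : convolution (conv_pow k) aug_proj = conv_pow k.+1.
Proof.
elim: k => [|k IH].
  by rewrite conv_unitl ?[RHS]conv_unitr //; exact: aug_proj_linear.
rewrite [conv_pow k.+1]/= convolutionA ?IH //; try exact: aug_proj_linear.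
exact: conv_pow_linear.
Qed.

Section Antipode.
Hypothesis conv_pow_nil :
  forall x, exists N, forall k, (N <= k)%N -> conv_pow k x = 0.

(* The inverse of [id = conv_unit + aug_proj] as a geometric series.        *)
Definition conv_inv (x : H) : H :=
  \sum_(k < projT1 (cid (conv_pow_nil x))) (-1) ^+ k *: conv_pow k x.

Lemma conv_invE M x : (forall k, (M <= k)%N -> conv_pow k x = 0) ->
  conv_inv x = \sum_(k < M) (-1) ^+ k *: conv_pow k x.
Proof.
rewrite /conv_inv; case: cid => N /= hN hM.
wlog le : N M hN hM / (N <= M)%N.
  move=> wl; case/orP: (leq_total N M) => le; first exact: wl.
  by apply/esym/wl.
rewrite -!(big_mkord xpredT (fun k => (-1) ^+ k *: conv_pow k x)).
rewrite (big_cat_nat (leq0n N) le) /= [X in _ + X]big_nat_cond.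
rewrite [X in _ + X]big1 ?addr0 // => k /andP[/andP[lek _] _].
by rewrite hN // scaler0.
Qed.

Lemma conv_pow_nil_seq (s : seq H) :
  exists N, forall x, x \in s -> forall k, (N <= k)%N -> conv_pow k x = 0.
Proof.
elim: s => [|y s [N hN]]; first by exists 0%N.
have [M hM] := conv_pow_nil y; exists (maxn M N) => x.
rewrite inE => /orP[/eqP->|xs] k; rewrite geq_max => /andP[? ?].
  exact: hM.
exact: hN.
Qed.

Lemma conv_inv_linear : linear conv_inv.
Proof.
move=> a x y; have [N hN] := conv_pow_nil_seq [:: x; y].
have hx := hN x (mem_head _ _).
have hy : forall k, (N <= k)%N -> conv_pow k y = 0.
  by apply: hN; rewrite !inE eqxx orbT.
rewrite (conv_invE hx) (conv_invE hy) (@conv_invE N).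
  rewrite scaler_sumr -big_split; apply: eq_bigr => k _ /=.
  by rewrite conv_pow_linear scalerDr !scalerA mulrC.
by move=> k le; rewrite conv_pow_linear hx // hy // scaler0 addr0.
Qed.

Let lid : linear (@id H). Proof. by []. Qed.

Lemma conv_inv_telescope N x (T : H) : (forall k, (N <= k)%N -> conv_pow k x = 0) ->
  T = \sum_(k < N) (-1) ^+ k *: conv_pow k.+1 x + conv_inv x ->
  T = (eps x)%:A.
Proof.
move=> hN ->; rewrite (@conv_invE N.+1) => [|k /ltnW]; last exact: hN.
rewrite big_ord_recl expr0 scale1r addrCA -big_split /= big1 ?addr0 // => k _.
by rewrite exprS mulN1r scaleNr subrr.
Qed.

Lemma id_unit_aug x : x = aug_proj x + conv_unit x.
Proof. by rewrite subrK. Qed.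

Lemma conv_inv_antipode : is_antipode D eps conv_inv.
Proof.
have lS := conv_inv_linear; have lJ := aug_proj_linear.
have lP := conv_pow_linear; have le := conv_unit_linear.
split=> // x; rewrite tensor_mul_map //; have [s Dx] := tensor_sum (D x).
all: have [N hN] := conv_pow_nil_seq (x :: [seq p.1 | p <- s] ++ [seq p.2 | p <- s]).
all: apply: (conv_inv_telescope (hN x (mem_head _ _))).
- rewrite -[LHS]/(convolution conv_inv id x) (convolutionE lS lid Dx).
  rewrite -{2}(conv_unitr lS) (convolutionE lS le Dx).
  under [X in _ = X + _]eq_bigr => k _.
    rewrite -conv_powSr (convolutionE (lP _) lJ Dx) scaler_sumr; over.
  rewrite exchange_big -big_split /= !big_seq; apply: eq_bigr => p ps.
  rewrite [X in _ * X]id_unit_aug mulrDr; congr (_ + _).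
  rewrite (conv_invE (hN p.1 _)); last first.
    by rewrite inE mem_cat map_f ?orbT.
  by rewrite mulr_suml; apply: eq_bigr => k _; rewrite scalerAl.
- rewrite -[LHS]/(convolution id conv_inv x) (convolutionE lid lS Dx).
  rewrite -{2}(conv_unitl lS) (convolutionE le lS Dx).
  under [X in _ = X + _]eq_bigr => k _.
    rewrite -[conv_pow k.+1 x]/(convolution aug_proj (conv_pow k) x).
    rewrite (convolutionE lJ (lP _) Dx) scaler_sumr; over.
  rewrite exchange_big -big_split /= !big_seq; apply: eq_bigr => p ps.
  rewrite [X in X * _]id_unit_aug mulrDl; congr (_ + _).
  rewrite (conv_invE (hN p.2 _)); last first.
    by rewrite inE mem_cat map_f ?orbT.
  by rewrite mulr_sumr; apply: eq_bigr => k _; rewrite scalerAr.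
Qed.

End Antipode.

Section GradedConnected.
Variable G : nat -> {pred H}.
Hypothesis G_space : is_graded_space G.
Hypothesis G1 : 1 \in G 0%N.
Hypothesis GM : forall i j x y, x \in G i -> y \in G j -> x * y \in G (i + j)%N.
Hypothesis G_comul : forall n x, x \in G n -> tensor_deg G n (D x).
Hypothesis G_counit : forall n x, (0 < n)%N -> x \in G n -> eps x = 0.
Hypothesis G_conn : is_connected G.

Let G_sub n := graded_submod G_space n.

Lemma graded_scale n a x : x \in G n -> a *: x \in G n.
Proof. by case: (G_sub n) => h0 h xn; rewrite -[_ *: _]addr0 h. Qed.

Lemma graded_sum n (I : eqType) (r : seq I) (F : I -> H) :
  (forall i, i \in r -> F i \in G n) -> \sum_(i <- r) F i \in G n.
Proof.
case: (G_sub n) => h0 h hF; rewrite big_seq.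
elim/big_ind: _ => // x y xn yn; by rewrite -[x]scale1r h.
Qed.

Lemma aug_proj0 x : x \in G 0 -> aug_proj x = 0.
Proof.
move=> /G_conn[c ->]; rewrite /aug_proj /conv_unit.
rewrite (_ : eps c%:A = c) ?subrr //.
have := counit_linear Dbi c 1 0; rewrite !addr0 => ->.
have := counit_linear Dbi (-1) 0 0; rewrite scaler0 addr0 mulN1r addNr => ->.
by case: (counit_morph Dbi) => -> _; rewrite addr0 mulr1.
Qed.

Lemma conv_unit_graded n x : x \in G n -> conv_unit x \in G n.
Proof.
case: n => [|n] xn; first exact: graded_scale.
by rewrite /conv_unit (G_counit _ xn) // scale0r; case: (G_sub n.+1).
Qed.

Lemma aug_proj_graded n x : x \in G n -> aug_proj x \in G n.
Proof.
move=> xn; have := conv_unit_graded xn; case: (G_sub n) => _ h en.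
by rewrite /aug_proj addrC -scaleN1r h.
Qed.

Lemma conv_pow_graded k n x : x \in G n -> conv_pow k x \in G n.
Proof.
elim: k n x => [|k IH] n x xn; first exact: conv_unit_graded.
have [s [hs Dx]] := G_comul xn.
rewrite /= (convolutionE aug_proj_linear (conv_pow_linear k) Dx).
apply: graded_sum => p /hs[i [j [<- pi pj]]].
by apply: GM; [exact: aug_proj_graded | exact: IH].
Qed.

Lemma conv_pow_vanish k n x : x \in G n -> (n < k)%N -> conv_pow k x = 0.
Proof.
elim: k n x => [|k IH] n x xn //; rewrite ltnS => le.
have [s [hs Dx]] := G_comul xn.
rewrite /= (convolutionE aug_proj_linear (conv_pow_linear k) Dx).
rewrite big_seq big1 // => p /hs[[|i] [j [ij pi pj]]].
  by rewrite aug_proj0 ?mul0r.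
by rewrite (IH j) ?mulr0 //; apply: leq_trans le; rewrite -ij addSn ltnS leq_addl.
Qed.

Lemma graded_connected_antipode : exists S, is_antipode D eps S /\
  forall n x, x \in G n -> S x \in G n.
Proof.
have nil x : exists N, forall k, (N <= k)%N -> conv_pow k x = 0.
  have [n [c [hc ->]]] := graded_span G_space x.
  exists n => k le; rewrite (linear_fun_sum _ _ (conv_pow_linear k)) big1 // => i _.
  exact: conv_pow_vanish (hc i) (leq_trans (ltn_ord i) le).
exists (conv_inv nil); split=> [|n x xn]; first exact: conv_inv_antipode.
rewrite /conv_inv; apply: graded_sum => k _.
exact/graded_scale/conv_pow_graded.
Qed.

End GradedConnected.

End Convolution.

(** * Operadic composition of trees *)

Section Trees.
Local Open Scope nat_scope.

Lemma over0 s : over troot s = s.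
Proof. by elim: s => //= l -> r _. Qed.

Lemma under0 t : under t troot = t.
Proof. by elim: t => //= l _ r ->. Qed.

Lemma overA a b c : over a (over b c) = over (over a b) c.
Proof. by elim: c => //= l -> r _. Qed.

Lemma underA a b c : under a (under b c) = under (under a b) c.
Proof. by elim: a => //= l _ r ->. Qed.

Lemma under_over a b c : b != troot -> under (over a b) c = over a (under b c).
Proof. by case: b. Qed.

Lemma mu_Node l r s1 x s2 : size s1 = order l ->
  mu (Node l r) (s1 ++ x :: s2) = over (mu l s1) (under x (mu r s2)).
Proof.
move=> sz /=; rewrite -sz take_size_cat // nth_cat ltnn subnn /=.
by rewrite drop_cat ltnNge leqnSn /= subSnn /= drop0.
Qed.

Lemma size_Node (T : Type) l r (s : seq T) : size s = order (Node l r) ->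
  exists s1 x s2, [/\ s = s1 ++ x :: s2, size s1 = order l & size s2 = order r].
Proof.
move=> sz; have lt : order l < size s by rewrite sz /= ltnS leq_addr.
case: s sz lt => // x0 s sz lt; exists (take (order l) (x0 :: s)).
exists (nth x0 (x0 :: s) (order l)), (drop (order l).+1 (x0 :: s)).
rewrite -drop_nth // cat_take_drop size_takel; last exact: ltnW.
by split=> //; rewrite size_drop sz subSS addKn.
Qed.

Lemma mu_over a b s1 s2 : size s1 = order a -> size s2 = order b ->
  mu (over a b) (s1 ++ s2) = over (mu a s1) (mu b s2).
Proof.
move=> sz1; elim: b s2 => [|l IH r _] s2; first by move/size0nil->; rewrite cats0.
case/size_Node => t1 [x] [t2] [-> szl szr].
rewrite catA -[over a _]/(Node (over a l) r).
rewrite (@mu_Node (over a l)) ?mu_Node //; last first.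
  by rewrite size_cat sz1 szl order_over.
by rewrite IH // overA.
Qed.

Lemma mu_under a b s1 s2 : troot \notin s1 ->
  size s1 = order a -> size s2 = order b ->
  mu (under a b) (s1 ++ s2) = under (mu a s1) (mu b s2).
Proof.
move=> s1n sz1 sz2; elim: a s1 s1n sz1 => [|l _ r IH] s1 s1n; first by move/size0nil->.
case/size_Node => t1 [x] [t2] [E szl szr]; move: s1n; rewrite {}E.
rewrite mem_cat inE !negb_or => /and3P[_ xn t2n].
rewrite -catA cat_cons -[under _ b]/(Node l (under r b)) !mu_Node //.
rewrite IH // underA under_over //.
by case: (x) xn.
Qed.

(* Operadic associativity of the t-products.                                *)
Lemma mu_mu p (r : seq (tree * seq tree)) : size r = order p ->
  all (fun x => (size x.2 == order x.1) && (troot \notin x.2)) r ->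
  mu (mu p (unzip1 r)) (flatten (unzip2 r)) = mu p [seq mu x.1 x.2 | x <- r].
Proof.
have szE (q : seq (tree * seq tree)) :
    all (fun x => (size x.2 == order x.1) && (troot \notin x.2)) q ->
    size (flatten (unzip2 q)) = \sum_(s <- unzip1 q) order s.
  elim: q => [|x q IH] /=; first by rewrite big_nil.
  by case/andP=> /andP[/eqP e _] /IH e'; rewrite size_cat big_cons e e'.
elim: p r => [|pl IHl pr IHr] r; first by move/size0nil->.
case/size_Node => r1 [x] [r2] [-> szl szr].
rewrite all_cat => /andP[h1 /andP[/andP[/eqP hx xn] h2]].
have -> : unzip1 (r1 ++ x :: r2) = unzip1 r1 ++ x.1 :: unzip1 r2.
  by rewrite /unzip1 map_cat.
have -> : flatten (unzip2 (r1 ++ x :: r2)) =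
    flatten (unzip2 r1) ++ x.2 ++ flatten (unzip2 r2).
  by rewrite /unzip2 map_cat flatten_cat.
rewrite map_cat map_cons !mu_Node ?size_map // mu_over.
- rewrite mu_under ?IHl ?IHr //.
  by rewrite szE // order_mu ?size_map.
- by rewrite szE // order_mu ?size_map.
- by rewrite size_cat order_under szE // hx order_mu // size_map.
Qed.

Lemma mu_vertices t : mu t (nseq (order t) tvertex) = t.
Proof.
elim: t => // l IHl r IHr.
by rewrite [order _]/= -addnS nseqD mu_Node ?size_nseq // IHl IHr.
Qed.

Lemma mu_vertex s : mu tvertex [:: s] = s.
Proof. by rewrite /= over0 under0. Qed.

Lemma order1 t : order t = 1 -> t = tvertex.
Proof. by case: t => // [[|? ?] [|? ?]] //= [] /eqP; rewrite ?addnS. Qed.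

End Trees.

(** * Sums over decompositions *)

Lemma pair_fsbig_dep (R : Type) (idx : R) (op : Monoid.com_law idx)
    (I J : choiceType) (A : set I) (B : I -> set J) (F : I -> J -> R) :
  finite_set A -> (forall i, finite_set (B i)) ->
  \big[op/idx]_(i \in A) \big[op/idx]_(j \in B i) F i j =
  \big[op/idx]_(p \in [set p : I * J | A p.1 /\ B p.1 p.2]) F p.1 p.2.
Proof.
move=> Af Bf; rewrite fsbig_finite //.
under eq_bigr => i _ do rewrite fsbig_finite //.
pose r := [seq (i, j) | i <- enum_fset (fset_set A),
                        j <- enum_fset (fset_set (B i))].
transitivity (\big[op/idx]_(p <- r) F p.1 p.2); first by rewrite big_allpairs_dep.
have rP p : (p \in r) = (p \in [set p : I * J | A p.1 /\ B p.1 p.2]).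
  apply/allpairsPdep/idP => [[i [j [iA jB ->]]]|].
    by apply/mem_set; move: iA jB; rewrite /= !in_fset_set // !inE.
  rewrite inE => -[iA jB]; exists p.1, p.2.
  by rewrite !in_fset_set // !mem_set // -surjective_pairing.
rewrite (@fsbigE _ _ _ _ _ r).
- by rewrite [RHS]big_seq_cond [LHS]big_seq; apply: eq_bigl => p; rewrite -rP andbb.
- apply: allpairs_uniq_dep => [|i _|[i j] [i' j'] _ _ /= [-> ->]] //.
- by move=> p /=; rewrite rP inE.
- by move=> p /mem_set; rewrite -rP => ->.
Qed.

Section LinearFsum.
Context {K : fieldType} (V W : lmodType K).

Lemma linear_fun_fsum (f : V -> W) (I : choiceType) (A : set I) (F : I -> V) :
  linear f -> finite_set A -> f (\sum_(i \in A) F i) = \sum_(i \in A) f (F i).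
Proof. by move=> lf Af; rewrite !fsbig_finite // linear_fun_sum. Qed.

End LinearFsum.

Lemma fsum_mul (R : pzRingType) (I J : choiceType) (A : set I) (B : set J)
    (F : I -> R) (G : J -> R) : finite_set A -> finite_set B ->
  (\sum_(i \in A) F i) * (\sum_(j \in B) G j) =
  \sum_(p \in [set p : I * J | A p.1 /\ B p.2]) F p.1 * G p.2.
Proof.
move=> Af Bf; rewrite -(pair_fsbig_dep _ (fun i j => F i * G j) Af (fun=> Bf)).
rewrite !fsbig_finite // mulr_suml; apply: eq_bigr => i _.
by rewrite mulr_sumr fsbig_finite.
Qed.

(* Meaningful only when [size ss = order (val t)].                          *)
Definition muY (t : Ybar) (ss : seq Ybar) : Ybar :=
  insubd vtree (mu (val t) (map val ss)).

Lemma sum_order_gt0 (ss : seq Ybar) :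
  (size ss <= \sum_(s <- map val ss) order s)%N.
Proof.
rewrite -sum1_size big_map; elim: ss => [|s ss IH]; first by rewrite !big_nil.
by rewrite !big_cons leq_add // (valP s).
Qed.

Lemma val_muY t ss : size ss = order (val t) ->
  val (muY t ss) = mu (val t) (map val ss).
Proof.
move=> sz; rewrite /muY val_insubd order_mu ?size_map //.
by rewrite ifT // (leq_trans _ (sum_order_gt0 ss)) // sz (valP t).
Qed.

Lemma mu_fiberP u t ss :
  mu_fiber u (t, ss) <-> size ss = order (val t) /\ muY t ss = u.
Proof.
split=> -[sz e]; split=> //; first by apply: val_inj; rewrite val_muY.
by rewrite -e val_muY.
Qed.

Lemma mu_fiber_vtree : mu_fiber vtree = [set (vtree, [:: vtree])].
Proof.
apply/seteqP; split=> [[t ss]|p ->]; last by split.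
case=> /= sz e; have := congr1 order e; rewrite order_mu ?size_map // => o1.
have le := sum_order_gt0 ss; rewrite o1 sz in le.
have tv : t = vtree.
  by apply/val_inj/order1/eqP; rewrite eqn_leq le (valP t).
subst t; case: ss sz e {o1 le} => // s [] // _ e; congr (_, [:: _]).
by apply/val_inj/(etrans _ e); rewrite [RHS]mu_vertex.
Qed.

Definition mu_fibers (zs : seq Ybar) : set (seq (Ybar * seq Ybar)) :=
  [set r | all (fun x => size x.2 == order (val x.1)) r /\
           [seq muY x.1 x.2 | x <- r] = zs].

Lemma mu_fibers_nil : mu_fibers [::] = [set [::]].
Proof. by apply/seteqP; split=> [[|x r] []|_ ->]. Qed.

Lemma mu_fibers_cons_bij z zs :
  set_bij [set p | mu_fiber z p.1 /\ mu_fibers zs p.2] (mu_fibers (z :: zs))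
    (fun p => p.1 :: p.2).
Proof.
split=> [[[t ss] r] /= [/mu_fiberP[sz <-] [wf <-]]||].
- by split=> //=; rewrite sz eqxx.
- by move=> [x r] [x' r'] _ _ /= [-> ->].
- move=> [|[t ss] r] [] //= /andP[/eqP sz wf] [ez ezs].
  by exists ((t, ss), r) => //=; split=> //; apply/mu_fiberP.
Qed.

Lemma mu_fibers_finite zs : finite_set (mu_fibers zs).
Proof.
elim: zs => [|z zs IH]; first by rewrite mu_fibers_nil; exact: finite_set1.
have [_ _ surj] := mu_fibers_cons_bij z zs.
exact/(sub_finite_set surj)/finite_image/(finite_setX (mu_fiber_finite z) IH).
Qed.

(* The terms of both sides of coassociativity at u are indexed by two-level *)
(* decompositions of u.  For u = mu_p(mu_q1(w1), ..., mu_qn(wn)), coded on  *)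
(* the right by p and r = [(q1, w1); ...; (qn, wn)], the left-hand side     *)
(* reads u = mu_(mu_p(q1, ..., qn))(w1 ... wn).                             *)
Definition mu_regroup (x : (Ybar * seq Ybar) * seq (Ybar * seq Ybar)) :=
  ((muY x.1.1 (unzip1 x.2), flatten (unzip2 x.2)), (x.1.1, unzip1 x.2)).

Lemma mu_regroupE (p : Ybar) (r : seq (Ybar * seq Ybar)) : size r = order (val p) ->
  all (fun x => size x.2 == order (val x.1)) r ->
  size (flatten (unzip2 r)) = order (val (muY p (unzip1 r))) /\
  muY (muY p (unzip1 r)) (flatten (unzip2 r)) =
    muY p [seq muY x.1 x.2 | x <- r].
Proof.
move=> sz wf.
have szr : size (unzip1 r) = order (val p) by rewrite size_map.
have szE : size (flatten (unzip2 r)) = order (val (muY p (unzip1 r))).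
  rewrite val_muY // order_mu ?size_map // {sz szr}.
  elim: r wf => [|x r IH] /=; first by rewrite big_nil.
  by case/andP=> /eqP e /IH; rewrite size_cat big_cons => -> ; rewrite e.
split=> //; apply: val_inj.
rewrite (val_muY szE) (val_muY szr) val_muY ?size_map //.
pose r' := [seq (val x.1, map val x.2) | x <- r].
have -> : map val (unzip1 r) = unzip1 r' by rewrite /unzip1 /r' -!map_comp.
have -> : map val (flatten (unzip2 r)) = flatten (unzip2 r').
  by rewrite map_flatten /unzip2 /r' -!map_comp.
rewrite mu_mu ?size_map //.
  congr (mu _ _); rewrite -!map_comp; apply/eq_in_map => x xr /=.
  by rewrite val_muY //; apply/eqP/(allP wf).
rewrite all_map; apply/allP => x xr /=; rewrite size_map (allP wf) //=.
by apply/mapP => -[[[|? ?] y0] _].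
Qed.

Lemma mu_regroup_bij u :
  set_bij [set x | mu_fiber u x.1 /\ mu_fibers x.1.2 x.2]
    [set y | mu_fiber u y.1 /\ mu_fiber y.1.1 y.2] mu_regroup.
Proof.
split=> [[[p zs] r] /= [/mu_fiberP[sz <-] [wf e]]||].
- rewrite -e size_map in sz.
  have [h1 h2] := mu_regroupE sz wf.
  by split; apply/mu_fiberP; rewrite ?size_map // h2 e.
- move=> [[p zs] r] [[p' zs'] r'] /set_mem[/= _ [wf e]] /set_mem[/= _ [wf' e']].
  case=> _ ef -> e1; suff er : r = r' by rewrite -e -e' er.
  have sh (q : seq (Ybar * seq Ybar)) :
      all (fun x => size x.2 == order (val x.1)) q ->
      shape (unzip2 q) = [seq order (val y) | y <- unzip1 q].
    move=> h; rewrite /shape /unzip1 /unzip2 -!map_comp.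
    by apply/eq_in_map => x /(allP h)/eqP.
  rewrite -(zip_unzip r) -(zip_unzip r') e1; congr zip.
  by apply: eq_from_flatten_shape; rewrite // !sh ?e1.
- move=> [[t ss] [p ts]] /= [/mu_fiberP[sz <-] /mu_fiberP[szp et]].
  pose sh := [seq order (val y) | y <- ts].
  pose r := zip ts (reshape sh ss).
  have szss : size ss = sumn sh.
    by rewrite sz -et val_muY // order_mu ?size_map // sumnE !big_map.
  have szr : size (reshape sh ss) = size ts by rewrite size_reshape size_map.
  have r1 : unzip1 r = ts by rewrite unzip1_zip ?szr.
  have r2 : unzip2 r = reshape sh ss by rewrite unzip2_zip ?szr.
  have wf : all (fun x => size x.2 == order (val x.1)) r.
    apply/(all_nthP (vtree, [::])) => i; rewrite size_zip szr minnn => lt.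
    rewrite nth_zip //= -(nth_map _ 0%N) ?szr //.
    have -> : [seq size s | s <- reshape sh ss] = sh.
      by apply: reshapeKl; rewrite szss.
    by rewrite (nth_map vtree).
  have szrp : size r = order (val p) by rewrite size_zip szr minnn.
  have [h1 h2] := mu_regroupE szrp wf.
  have fl : flatten (unzip2 r) = ss by rewrite r2 reshapeKr ?szss.
  exists ((p, [seq muY x.1 x.2 | x <- r]), r).
    split=> //=; apply/mu_fiberP; rewrite size_map; split=> //.
    by rewrite -h2 r1 et fl.
  by rewrite /mu_regroup /= r1 fl et.
Qed.

(** * The free algebra on trees *)

Definition word_coef (w : {fmonom Ygen}) (x : HY) : rat := mcoeff w x.

Lemma word_coef_linear w : scalar (word_coef w).
Proof. by move=> a x y; rewrite /word_coef mcoeffD mcoeffZ. Qed.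

Lemma HY_coefP (x y : HY) : (forall w, word_coef w x = word_coef w y) -> x = y.
Proof. by move=> h; apply/malgP. Qed.

Definition word (w : {fmonom Ygen}) : HY := << w >>.

Lemma wordE w : word w = \prod_(i <- fmonom_val w) freegen rat i.
Proof.
case: w => s /=; elim: s => [|i s IH]; first by rewrite big_nil /word -fmoneE.
rewrite big_cons -IH /word /freegen malgME !msuppU !oner_eq0 !big_seq_fset1.
by rewrite !mcoeffUU mulr1 /mmul /= fmmulE fmuE.
Qed.

Lemma word_coef_word w w' : word_coef w' (word w) = (w == w')%:R.
Proof. exact: mcoeffU1. Qed.

Lemma wordM w w' : word w * word w' = word (mmul w w').
Proof. by rewrite !wordE fmM big_cat. Qed.

Lemma word1 : word mone = 1.
Proof. by rewrite wordE fm1 big_nil. Qed.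

Lemma HY_sum_words (x : HY) :
  x = \sum_(w <- enum_fset (msupp x)) word_coef w x *: word w.
Proof.
rewrite [LHS]monalgE; apply: eq_bigr => w _.
by apply/malgP => j; rewrite mcoeffZ !mcoeffU mulr_natr.
Qed.

Lemma freegen_word w : freegen rat w = word (fmu w). Proof. by []. Qed.

Definition Ybar_of (w : Ygen) : Ybar := Sub (val w) (ltnW (valP w)).

Lemma gen_Ybar_of w : gen (Ybar_of w) = freegen rat w.
Proof. by rewrite /gen SubK valK. Qed.

Lemma gen_vtree : gen vtree = 1. Proof. by rewrite /gen insubF. Qed.

Lemma Ybar_ind (P : Ybar -> Prop) :
  P vtree -> (forall w, P (Ybar_of w)) -> forall u, P u.
Proof.
move=> Pv Pw u; have [e|ne] := eqVneq (order (val u)) 1%N.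
  by rewrite (_ : u = vtree) //; apply/val_inj/order1.
have lt : (1 < order (val u))%N by rewrite ltn_neqAle eq_sym ne (valP u).
by rewrite (_ : u = Ybar_of (Sub (val u) lt)) //; exact: val_inj.
Qed.

Lemma Ybar_of_neq w : Ybar_of w != vtree.
Proof. by apply/eqP => /(congr1 val) e; have := valP w; rewrite [val w]e. Qed.

Lemma HY_ind (P : HY -> Prop) : P 1 -> (forall u x, P x -> P (gen u * x)) ->
  (forall a x y, P x -> P y -> P (a *: x + y)) -> forall x, P x.
Proof.
move=> P1 PM PL.
have P0 : P 0 by rewrite -(addNr (1 : HY)) -scaleN1r; exact: PL.
have Pw w : P (word w).
  rewrite wordE; elim: (fmonom_val w) => [|i s IH]; first by rewrite big_nil.
  by rewrite big_cons -gen_Ybar_of; exact: PM.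
move=> x; rewrite [x]HY_sum_words; elim: (enum_fset _) => [|w s IH].
  by rewrite big_nil.
by rewrite big_cons; exact: PL.
Qed.

Lemma HY_morph_eq (V : lmodType rat) (m : V -> V -> V) (f g : HY -> V) :
  linear f -> linear g -> f 1 = g 1 ->
  (forall x y, f (x * y) = m (f x) (f y)) ->
  (forall x y, g (x * y) = m (g x) (g y)) ->
  (forall u, f (gen u) = g (gen u)) -> f =1 g.
Proof.
move=> lf lg fg1 fM gM fg; elim/HY_ind => // [u x IH|a x y IHx IHy].
  by rewrite fM gM fg IH.
by rewrite lf lg IHx IHy.
Qed.

Definition aug : HY -> rat := word_coef mone.

Lemma aug_linear : scalar aug. Proof. exact: word_coef_linear. Qed.

Lemma aug_morph : monoid_morphism aug.
Proof.
have h := @mcoeff1g_is_multiplicative {fmonom Ygen} rat.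
by split; [exact: h.2 | exact: h.1].
Qed.

Lemma gen_coef u w : word_coef (fmu w) (gen u) = (u == Ybar_of w)%:R.
Proof.
elim/Ybar_ind: u => [|w'].
  rewrite gen_vtree -word1 word_coef_word eq_sym fm1_eq1.
  by rewrite eq_sym (negPf (Ybar_of_neq w)).
rewrite gen_Ybar_of freegen_word word_coef_word; congr (nat_of_bool _)%:R.
apply/idP/idP => /eqP; last first.
  by move=> /(congr1 val) e; apply/eqP; congr fmu; exact: val_inj.
by move/(congr1 (@fmonom_val _)); rewrite !fmU => -[->].
Qed.

Lemma aug_gen u : aug (gen u) = (u == vtree)%:R.
Proof.
elim/Ybar_ind: u => [|w]; first by rewrite gen_vtree aug_morph.1 eqxx.
by rewrite gen_Ybar_of freegen_word /aug word_coef_word fm1_eq1 (negPf (Ybar_of_neq w)).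
Qed.

Lemma tens11_neq0 : (1 : tensor HY HY) != 0.
Proof.
have b := functional_bilin aug_linear aug_linear.
apply/eqP => /(congr1 (tlift (fun x y => aug x * aug y : rat^o))).
rewrite (linear_fun0 (tlift_linear b)) -tens11 tlift_tens // aug_morph.1.
by move/eqP; rewrite mulr1 oner_eq0.
Qed.

HB.instance Definition _ :=
  GRing.PzSemiRing_isNonZero.Build (tensor HY HY) tens11_neq0.
HB.instance Definition _ :=
  GRing.Lmodule_isLalgebra.Build rat (tensor HY HY) (@tensor_scaleAl _ HY HY).
HB.instance Definition _ :=
  GRing.Lalgebra_isAlgebra.Build rat (tensor HY HY) (@tensor_scaleAr _ HY HY).

(** * The coproduct *)

Definition prod_gen (ss : seq Ybar) : HY := \prod_(s <- ss) gen s.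

Definition delta (u : Ybar) : tensor HY HY :=
  \sum_(p \in mu_fiber u) tens (gen p.1) (prod_gen p.2).

Lemma delta_vtree : delta vtree = 1.
Proof.
by rewrite /delta mu_fiber_vtree fsbig_set1 /prod_gen big_seq1 gen_vtree.
Qed.

Lemma aug_prod_gen ss : aug (prod_gen ss) = (all (pred1 vtree) ss)%:R.
Proof.
elim: ss => [|s ss IH]; first by rewrite /prod_gen big_nil aug_morph.1.
by rewrite /prod_gen big_cons aug_morph.2 aug_gen [aug _]IH -natrM mulnb.
Qed.

Lemma tensor_assoc1 :
  tensor_assoc (1 : tensor (tensor HY HY) HY) = (1 : tensor HY (tensor HY HY)).
Proof. exact: (@tensor_assocE _ HY HY HY 1 1 1). Qed.

Lemma tensor_assoc_morph (x y : tensor (tensor HY HY) HY) :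
  tensor_assoc (x * y) = tensor_assoc x * tensor_assoc y.
Proof.
have HL (c : rat) (x' y' : tensor HY (tensor HY HY)) :
    c *: (x' * y') = (c *: x') * y' := tensor_scaleAl c x' y'.
have HR (c : rat) (x' y' : tensor HY (tensor HY HY)) :
    c *: (x' * y') = x' * (c *: y') := tensor_scaleAr c x' y'.
have [h1 _] := tens_bilin (tensor HY HY) HY.
have lA := @tensor_assoc_linear _ HY HY HY.
have E s b : tensor_assoc (tens (\sum_(p <- s) tens p.1 p.2) b) =
    \sum_(p <- s) tens p.1 (tens p.2 b) :> tensor HY (tensor HY HY).
  rewrite (linear_fun_sum _ _ (h1 b)) (linear_fun_sum _ _ lA); apply: eq_bigr => p _.
  exact: tensor_assocE.
move: x y; apply: (@tensor_morph _ (tensor HY HY) HY (tensor HY (tensor HY HY))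
  (fun a b => a * b) (@tensor_assoc _ HY HY HY) lA) => [y a x x'|x a y y'|].
- by rewrite mulrDl HL.
- by rewrite mulrDr HR.
move=> a b a' b'; have [s ->] := tensor_sum a; have [s' ->] := tensor_sum a'.
apply: etrans (congr1 (fun z => tensor_assoc (tens z _)) (tensorM_sum s s')) _.
apply: etrans (E _ _) (etrans _ (esym (congr2 *%R (E s b) (E s' b')))).
rewrite big_allpairs_dep mulr_suml; apply: eq_bigr => p _.
rewrite mulr_sumr; apply: eq_bigr => q _.
exact: esym (etrans (tensM _ _ _ _) (congr1 _ (tensM _ _ _ _))).
Qed.

Section Coproduct.
Variable Delta : {lrmorphism HY -> tensor HY HY}.
Hypothesis Delta_gen : forall u, Delta (gen u) = delta u.

Let Delta_linear : linear Delta. Proof. by move=> a x y; rewrite linearP. Qed.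
Let Delta_morph : monoid_morphism Delta.
Proof. by split; [exact: rmorph1 | exact: rmorphM]. Qed.
Let lid : linear (@id HY). Proof. by []. Qed.
Let mid : monoid_morphism (@id HY). Proof. by []. Qed.

Lemma Delta_prod_gen zs :
  Delta (prod_gen zs) =
  \sum_(r \in mu_fibers zs) tens (prod_gen (unzip1 r)) (prod_gen (flatten (unzip2 r))).
Proof.
elim: zs => [|z zs IH].
  by rewrite mu_fibers_nil fsbig_set1 /prod_gen !big_nil Delta_morph.1.
rewrite /prod_gen big_cons Delta_morph.2 Delta_gen [Delta _]IH fsum_mul; last first.
- exact: mu_fibers_finite.
- exact: mu_fiber_finite.
rewrite (reindex_fsbig _ _ _ _ (mu_fibers_cons_bij z zs)); apply: eq_fsbigr => p _.
by rewrite tensM /prod_gen /= !big_cons big_cat.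
Qed.

Lemma Delta_coassoc x :
  tensor_assoc (tensor_map Delta id (Delta x)) = tensor_map id Delta (Delta x).
Proof.
have lL := tensor_map_linear Delta_linear lid.
have lR := tensor_map_linear lid Delta_linear.
have lA := @tensor_assoc_linear _ HY HY HY.
move: x; apply: (@HY_morph_eq (tensor HY (tensor HY HY)) (fun a b => a * b)
  (fun x => tensor_assoc (tensor_map Delta id (Delta x)))
  (fun x => tensor_map id Delta (Delta x))).
- exact: linear_fun_comp (linear_fun_comp Delta_linear lL) lA.
- exact: linear_fun_comp Delta_linear lR.
- rewrite rmorph1 (tensor_map1 Delta_linear lid Delta_morph mid) tensor_assoc1.
  by rewrite (tensor_map1 lid Delta_linear mid Delta_morph).
- move=> x y; rewrite rmorphM (tensor_map_morph Delta_linear lid) //.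
  exact: tensor_assoc_morph.
- by move=> x y; rewrite rmorphM (tensor_map_morph lid Delta_linear).
move=> u; rewrite Delta_gen /delta.
rewrite (linear_fun_fsum _ lL (mu_fiber_finite u)).
rewrite (linear_fun_fsum _ lA (mu_fiber_finite u)).
rewrite (linear_fun_fsum _ lR (mu_fiber_finite u)).
pose F (y : (Ybar * seq Ybar) * (Ybar * seq Ybar)) : tensor HY (tensor HY HY) :=
  tens (gen y.2.1) (tens (prod_gen y.2.2) (prod_gen y.1.2)).
transitivity (\sum_(p \in mu_fiber u) \sum_(q \in mu_fiber p.1) F (p, q)).
  apply: eq_fsbigr => p _; rewrite tensor_mapE // Delta_gen /delta.
  have [h1 _] := tens_bilin (tensor HY HY) HY.
  rewrite (linear_fun_fsum _ (h1 _) (mu_fiber_finite _)).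
  rewrite (linear_fun_fsum _ lA (mu_fiber_finite _)).
  by apply: eq_fsbigr => q _; exact: tensor_assocE.
transitivity (\sum_(p \in mu_fiber u) \sum_(r \in mu_fibers p.2) F (mu_regroup (p, r))).
  rewrite !pair_fsbig_dep; try exact: mu_fiber_finite.
  - rewrite (reindex_fsbig _ _ _ _ (mu_regroup_bij u)).
    by apply: eq_fsbigr => -[p r] _.
  - by move=> p; exact: mu_fibers_finite.
  - by move=> p; exact: mu_fiber_finite.
apply: eq_fsbigr => p _; rewrite tensor_mapE // Delta_prod_gen.
have [_ h2] := tens_bilin HY (tensor HY HY).
by rewrite (linear_fun_fsum _ (h2 _) (mu_fibers_finite _)).
Qed.

Lemma Delta_counitl x : tlift (fun a b => aug a *: b) (Delta x) = x.
Proof.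
have lT := tlift_linear (@scale_bilinl _ HY HY _ aug_linear).
have TE := tlift_tens (@scale_bilinl _ HY HY _ aug_linear).
move: x; apply: (@HY_morph_eq HY (fun a b => a * b)
  (fun x => (tlift (fun a b => aug a *: b)) (Delta x)) id) => //.
- exact: linear_fun_comp Delta_linear lT.
- by rewrite rmorph1; apply: etrans (TE 1 1) _; rewrite aug_morph.1 scale1r.
- by move=> x y; rewrite rmorphM; apply: tlift_scalel_morph aug_linear aug_morph.2 _ _.
move=> u; rewrite Delta_gen (linear_fun_fsum _ lT (mu_fiber_finite u)).
have fu : mu_fiber u (vtree, [:: u]) by split=> //=; exact: mu_vertex.
rewrite (fsbigD1 (vtree, [:: u]) _ _ (mu_fiber_finite u) fu) fsbig1.
  by rewrite [LHS]addr0 TE aug_gen eqxx scale1r /prod_gen big_seq1.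
move=> [t ss] /= [[/= sz e] ne]; rewrite TE aug_gen.
have [tv|] := eqVneq t vtree; last by rewrite scale0r.
case: ne; move: sz e; rewrite tv; case: ss => // s [] // _ e.
by congr (_, [:: _]); apply/val_inj/(etrans _ e); rewrite [RHS]mu_vertex.
Qed.

Lemma Delta_counitr x : tlift (fun a b => aug b *: a) (Delta x) = x.
Proof.
have lT := tlift_linear (@scale_bilinr _ HY HY _ aug_linear).
have TE := tlift_tens (@scale_bilinr _ HY HY _ aug_linear).
move: x; apply: (@HY_morph_eq HY (fun a b => a * b)
  (fun x => (tlift (fun a b => aug b *: a)) (Delta x)) id) => //.
- exact: linear_fun_comp Delta_linear lT.
- by rewrite rmorph1; apply: etrans (TE 1 1) _; rewrite aug_morph.1 scale1r.
- by move=> x y; rewrite rmorphM; apply: tlift_scaler_morph aug_linear aug_morph.2 _ _.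
move=> u; rewrite Delta_gen (linear_fun_fsum _ lT (mu_fiber_finite u)).
pose vs := nseq (order (val u)) vtree.
have fu : mu_fiber u (u, vs).
  by split; rewrite /= ?size_nseq // map_nseq; exact: mu_vertices.
rewrite (fsbigD1 (u, vs) _ _ (mu_fiber_finite u) fu) fsbig1.
  by rewrite [LHS]addr0 TE aug_prod_gen all_nseq /= eqxx orbT scale1r.
move=> [t ss] /= [[/= sz e] ne]; rewrite TE aug_prod_gen.
have [/all_pred1P ev|] := boolP (all _ _); last by rewrite scale0r.
case: ne; move: e; rewrite ev map_nseq sz => e.
have tu : t = u by apply/val_inj/(etrans (esym (mu_vertices _)) e).
by rewrite /vs -tu.
Qed.

End Coproduct.

(** * The grading *)

Section TensorDegree.
Context {K : fieldType} (H : algType K) (G : nat -> {pred H}).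
Hypothesis GM : forall i j x y, x \in G i -> y \in G j -> x * y \in G (i + j)%N.
Hypothesis GZ : forall n a x, x \in G n -> a *: x \in G n.

Lemma tensor_deg0 n : tensor_deg G n 0.
Proof. by exists [::]; rewrite big_nil. Qed.

Lemma tensor_degP n a (z z' : tensor H H) :
  tensor_deg G n z -> tensor_deg G n z' -> tensor_deg G n (a *: z + z').
Proof.
move=> [s [hs ->]] [s' [hs' ->]].
exists ([seq (a *: p.1, p.2) | p <- s] ++ s'); split.
  move=> q; rewrite mem_cat => /orP[/mapP[p /hs[i [j [ij pi pj]]] ->]|/hs'//].
  by exists i, j; split=> //=; exact: GZ.
rewrite big_cat big_map scaler_sumr; congr (_ + _); apply: eq_bigr => p _.
by have [h _] := tens_bilin H H; rewrite -(linear_funZ (h p.2)).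
Qed.

Lemma tensor_degM m n (z z' : tensor H H) :
  tensor_deg G m z -> tensor_deg G n z' -> tensor_deg G (m + n)%N (z * z').
Proof.
move=> [s [hs ->]] [s' [hs' ->]]; rewrite tensorM_sum.
eexists; split; last by [].
move=> _ /allpairsP[[p q] [/hs[i [j [<- pi pj]]] /hs'[k [l [<- qk ql]]] ->]] /=.
by exists (i + k)%N, (j + l)%N; rewrite !GM // addnACA.
Qed.

End TensorDegree.

Lemma HY_degP n x :
  reflect (forall w, word_coef w x != 0 -> word_deg w = n) (x \in HY_deg n).
Proof.
by apply: (iffP allP) => h w; [|rewrite -mcoeff_neq0 => /h->//];
  rewrite -/(msupp _) => ?; apply/eqP/h; rewrite -mcoeff_neq0.
Qed.

Lemma HY_deg_submod n : submod_closed (HY_deg n).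
Proof.
split=> [|a x y /HY_degP hx /HY_degP hy]; apply/HY_degP => w.
  by rewrite /word_coef mcoeff0 eqxx.
rewrite word_coef_linear; have [x0|/hx//] := eqVneq (word_coef w x) 0.
by rewrite x0 mulr0 add0r => /hy.
Qed.

Lemma HY_degZ n a x : x \in HY_deg n -> a *: x \in HY_deg n.
Proof. by case: (HY_deg_submod n) => h0 h xn; rewrite -[_ *: _]addr0 h. Qed.

Lemma word_degM w w' : word_deg (mmul w w') = (word_deg w + word_deg w')%N.
Proof. by rewrite /word_deg fmM big_cat. Qed.

Lemma word_deg1 : word_deg mone = 0%N.
Proof. by rewrite /word_deg fm1 big_nil. Qed.

Lemma HY_degM i j x y :
  x \in HY_deg i -> y \in HY_deg j -> x * y \in HY_deg (i + j)%N.
Proof.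
move=> /HY_degP hx /HY_degP hy; apply/HY_degP => w.
rewrite /word_coef mcoeff_neq0 => /msuppM_le[w1 [w2 [h1 h2 ->]]].
by rewrite word_degM hx ?hy // /word_coef mcoeff_neq0.
Qed.

Lemma word_deg_word w : word w \in HY_deg (word_deg w).
Proof.
apply/HY_degP => w'; rewrite word_coef_word.
by case: (w =P w') => [->|_] //; rewrite eqxx.
Qed.

Lemma HY_deg1 : 1 \in HY_deg 0.
Proof. by rewrite -word1 -word_deg1; exact: word_deg_word. Qed.

Lemma gen_deg u : gen u \in HY_deg (order (val u)).-1.
Proof.
elim/Ybar_ind: u => [|w]; first by rewrite gen_vtree; exact: HY_deg1.
rewrite gen_Ybar_of freegen_word.
rewrite (_ : _.-1 = word_deg (fmu w)) ?word_deg_word //.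
by rewrite /word_deg fmU big_seq1.
Qed.

Lemma prod_gen_deg ss :
  prod_gen ss \in HY_deg (\sum_(s <- ss) (order (val s)).-1)%N.
Proof.
elim: ss => [|s ss IH]; rewrite /prod_gen; first by rewrite !big_nil; exact: HY_deg1.
by rewrite !big_cons; apply: HY_degM IH; exact: gen_deg.
Qed.

Lemma delta_deg u : tensor_deg HY_deg (order (val u)).-1 (delta u).
Proof.
exists [seq (gen p.1, prod_gen p.2) | p <- enum_fset (fset_set (mu_fiber u))].
split; last by rewrite /delta fsbig_finite ?big_map //; exact: mu_fiber_finite.
move=> _ /mapP[[t ss] + ->]; rewrite in_fset_set; last exact: mu_fiber_finite.
rewrite inE => -[/= sz e]; exists (order (val t)).-1.
exists (\sum_(s <- ss) (order (val s)).-1)%N.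
split; [|exact: gen_deg|exact: prod_gen_deg].
rewrite -e order_mu ?size_map // big_map.
have -> : (\sum_(s <- ss) order (val s) = \sum_(s <- ss) (order (val s)).-1 + size ss)%N.
  rewrite -sum1_size -big_split; apply: eq_bigr => s _ /=.
  by rewrite addn1 prednK // (valP s).
by rewrite sz; case: (order (val t)) (valP t) => // k _; rewrite addnS /= addnC.
Qed.

Lemma HY_graded_space : is_graded_space HY_deg.
Proof.
split=> [n|x|n c hc c0 i]; first exact: HY_deg_submod.
- pose N := (\max_(w <- enum_fset (msupp x)) word_deg w).+1.
  exists N, (fun i : 'I_N => \sum_(w <- enum_fset (msupp x) | word_deg w == i)
                               word_coef w x *: word w); split=> [i|].
    have [h0 h] := HY_deg_submod i.
    apply: (big_ind (fun z => z \in HY_deg i)) => // [z z' hz hz'|w /eqP <-].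
      by rewrite -[z]scale1r h.
    exact/HY_degZ/word_deg_word.
  rewrite [LHS]HY_sum_words (exchange_big_dep xpredT) //= big_seq [RHS]big_seq.
  apply: eq_bigr => w wx; have ltN : (word_deg w < N)%N.
    by rewrite ltnS (bigD1_seq w) ?fset_uniq //= leq_maxl.
  by rewrite (big_pred1 (Ordinal ltN)) // => i; rewrite eq_sym.
apply: HY_coefP => w; rewrite [RHS]mcoeff0.
have [//|ne] := eqVneq (word_coef w (c i)) 0.
have dw : word_deg w = i by apply/HY_degP: ne.
have := congr1 (word_coef w) c0; rewrite [RHS]mcoeff0 [LHS]raddf_sum.
rewrite (bigD1 i) //= big1 ?addr0 // => j ji; apply/eqP; apply: contraNT ji => nej.
have dj : word_deg w = j by apply/HY_degP: nej.
by apply/eqP/val_inj; rewrite /= -dj.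
Qed.

Lemma HY_connected : is_connected HY_deg.
Proof.
move=> x; split=> [/HY_degP h|[c ->]]; last exact/HY_degZ/HY_deg1.
exists (aug x); apply: HY_coefP => w.
rewrite [RHS](_ : _ = aug x * word_coef w 1); last exact: mcoeffZ.
rewrite -word1 word_coef_word; have [<-|ne] := eqVneq; first by rewrite mulr1.
rewrite mulr0; have [//|/h] := eqVneq (word_coef w x) 0.
rewrite /word_deg => dw; case/eqP: ne; apply/eqP; rewrite eq_sym fmP fm1.
case: (fmonom_val w) dw => // i s; rewrite big_cons => /eqP.
by rewrite addn_eq0 -subn1 subn_eq0 leqNgt (valP i).
Qed.

Lemma aug_deg n x : (0 < n)%N -> x \in HY_deg n -> aug x = 0.
Proof.
move=> n0 /HY_degP h; apply/eqP; apply: contraLR n0 => /h.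
by rewrite word_deg1 => <-.
Qed.

Lemma HY_not_commutative : ~ is_commutative HY.
Proof.
pose a : Ygen := Sub (Node tvertex troot) isT.
pose b : Ygen := Sub (Node troot tvertex) isT.
move=> /(_ (freegen rat a) (freegen rat b)) /(congr1 (word_coef (mmul (fmu a) (fmu b)))).
rewrite !freegen_word !wordM !word_coef_word eqxx.
rewrite (_ : (mmul (fmu b) (fmu a) == _) = false) //.
by apply/eqP => /(congr1 (@fmonom_val _)); rewrite !fmM !fmU => -[].
Qed.

(* The coproduct of [Node b troot], with [a] and [b] the two trees of order *)
(* 2, is primitive up to the single non-symmetric term [a (x) b].           *)
Lemma delta_not_cocommutative : exists u, tensor_swap (delta u) <> delta u.
Proof.
pose a : Ygen := Sub (Node tvertex troot) isT.
pose b : Ygen := Sub (Node troot tvertex) isT.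
pose u : Ybar := Sub (Node (val b) troot) isT; exists u.
have fin := mu_fiber_finite u.
have cb := functional_bilin (word_coef_linear (fmu a)) (word_coef_linear (fmu b)).
have lT := tlift_linear cb; have TE := tlift_tens cb.
move=> /(congr1 (tlift (fun x y => word_coef (fmu a) x * word_coef (fmu b) y : rat^o))).
rewrite /delta (linear_fun_fsum _ (@tensor_swap_linear _ HY HY) fin).
rewrite !(linear_fun_fsum _ lT fin) fsbig1 => [|[t ss] /= [/= sz e]]; last first.
  rewrite tensor_swapE TE gen_coef.
  have [tb|] := eqVneq t (Ybar_of b); last by rewrite mulr0.
  exfalso; case: ss sz e => [|[t1 o1] [|[t2 o2] []]]; rewrite tb //= !over0 under0 => _.
  by case: t1 o1 => // l1 [|? ?] _; case: t2 o2.
have fu : mu_fiber u (Ybar_of a, [:: Ybar_of b; vtree]) by [].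
rewrite (fsbigD1 _ _ _ fin fu) fsbig1.
  rewrite [RHS]addr0 TE gen_coef eqxx /prod_gen !big_cons big_nil gen_vtree !mulr1.
  by rewrite gen_coef eqxx.
move=> [t ss] /= [[/= sz e] ne]; rewrite TE gen_coef.
have [ta|] := eqVneq t (Ybar_of a); last by rewrite mul0r.
case: ne; move: sz e; rewrite ta.
case: ss => [|s1 [|s2 []]] //= _; rewrite !over0 !under0.
rewrite -[LHS]/(Defs.over (val s1) (val s2)) => e.
have [e1 e2] : val s1 = val b /\ val s2 = tvertex.
  move: (val s1) (val s2) (valP s1) (valP s2) e => t1 [|l r] o1 //= _ [+ ->].
  by case: l => [/= ->|l' r' /= [e3 _]] //; case: l' e3 => //= e3; rewrite e3 in o1.
by congr (_, [:: _; _]); apply: val_inj.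
Qed.

Theorem corollary2p8 :
  exists (Delta : HY -> tensor HY HY) (eps : HY -> rat),
    [/\ forall u : Ybar,
          Delta (gen u) =
            \sum_(p \in mu_fiber u) tens (gen p.1) (\prod_(s <- p.2) gen s),
        forall u : Ybar, u != vtree -> eps (gen u) = 0,
        is_graded_hopf_algebra Delta eps HY_deg,
        is_connected HY_deg
      & ~ is_commutative HY /\ ~ is_cocommutative Delta].
Proof.
have [Delta Delta_gen _] := HY_universal delta_vtree.
have lD : linear Delta by move=> a x y; rewrite linearP.
have mD : monoid_morphism Delta by split; [exact: rmorph1 | exact: rmorphM].
have bi : is_bialgebra Delta aug.
  split=> //; [exact: aug_linear | exact: aug_morph | exact: Delta_coassoc
    | exact: Delta_counitl | exact: Delta_counitr].
have deg n x : x \in HY_deg n -> tensor_deg HY_deg n (Delta x).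
  move=> /HY_degP xn; rewrite [x]HY_sum_words (linear_fun_sum _ _ lD).
  rewrite big_seq; apply: big_ind => [||w wx].
  - exact: tensor_deg0.
  - by move=> z z' hz hz'; rewrite -[z]scale1r; apply: tensor_degP => //; exact: HY_degZ.
  rewrite (linear_funZ lD) -[_ *: _]addr0.
  apply: tensor_degP => [||]; [exact: HY_degZ | | exact: tensor_deg0].
  have <- : word_deg w = n by apply: xn; rewrite /word_coef mcoeff_neq0.
  rewrite wordE /word_deg; elim: (fmonom_val w) => [|i s IH].
    rewrite !big_nil mD.1; exists [:: (1, 1)]; rewrite big_seq1; split=> //.
    move=> _ /[1!inE] /eqP ->; exists 0%N, 0%N; split=> //; exact: HY_deg1.
  rewrite !big_cons mD.2; apply: tensor_degM IH; first exact: HY_degM.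
  by rewrite -gen_Ybar_of Delta_gen; exact: (delta_deg (Ybar_of i)).
exists Delta, aug; split.
- exact: Delta_gen.
- by move=> u /negPf uv; rewrite aug_gen uv.
- split.
  + exact: HY_graded_space.
  + exact: HY_deg1.
  + exact: HY_degM.
  + exact: deg.
  + exact: aug_deg.
  + exact: bi.
  + exact: (graded_connected_antipode bi HY_graded_space HY_deg1 HY_degM deg
      aug_deg HY_connected).
- exact: HY_connected.
- split; first exact: HY_not_commutative.
  by move=> cc; have [u] := delta_not_cocommutative; rewrite -!Delta_gen.
Qed.
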